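(* Suppose $\Omega\subset\mathbb C$ is a smooth Jordan domain, i.e. a bounded simply connected domain whose boundary $b\Omega$ is a $C^\infty$ smooth Jordan curve. (i) Let $U\in C^\infty(\overline\Omega)$. Then there is $\varphi\in C^\infty(\overline\Omega)$ that vanishes on $b\Omega$ and such that $\frac{\partial\varphi}{\partial\bar z}$ agrees with $U$ on $b\Omega$ up to infinite order. (ii) Let $V\in C^\infty(\mathbb C)$. Then there is $\Phi\in C^\infty(\mathbb C)$ that vanishes on $b\Omega$ and such that $\frac{\partial\Phi}{\partial\bar z}$ agrees with $V$ on $b\Omega$ up to infinite order.
   Context: Functions are complex valued, and $\frac{\partial}{\partial\bar z}=\frac12\left(\frac{\partial}{\partial x}+i\frac{\partial}{\partial y}\right)$. Two $C^\infty$ functions agree on $b\Omega$ up to infinite order if their difference and all of its partial derivatives (in $x,y$) of every order vanish at every point of $b\Omega$. *)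

(* Defs.v *)
From Stdlib Require Import Reals List.
From Coquelicot Require Import Coquelicot.
Open Scope R_scope.

(** ** Topology of the plane *)

Definition closure (A : C -> Prop) (z : C) : Prop :=
  forall N : C -> Prop, locally z N -> exists w, N w /\ A w.

Definition boundary (A : C -> Prop) (z : C) : Prop :=
  closure A z /\ closure (fun w => ~ A w) z.

Definition bounded (A : C -> Prop) : Prop :=
  exists M : R, forall z, A z -> Cmod z <= M.

Definition connected (A : C -> Prop) : Prop :=
  forall P Q : C -> Prop, open P -> open Q ->
    (forall z, A z -> P z \/ Q z) ->
    (exists z, A z /\ P z) -> (exists z, A z /\ Q z) ->
    exists z, A z /\ P z /\ Q z.

Definition domain (A : C -> Prop) : Prop :=
  open A /\ connected A /\ exists z, A z.

Definition unit_interval (t : R) : Prop := 0 <= t <= 1.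

Definition unit_square (p : R * R) : Prop :=
  unit_interval (fst p) /\ unit_interval (snd p).

(** [H (s, t)] is the point of parameter [t] on the loop at time [s]. *)
Definition simply_connected (A : C -> Prop) : Prop :=
  forall c : R -> C,
    continuous_on unit_interval c ->
    (forall t, unit_interval t -> A (c t)) ->
    c 0 = c 1 ->
    exists H : R * R -> C,
      continuous_on unit_square H /\
      (forall p, unit_square p -> A (H p)) /\
      (forall t, unit_interval t -> H (0, t) = c t) /\
      (forall t, unit_interval t -> H (1, t) = c 0) /\
      (forall s, unit_interval s -> H (s, 0) = c 0 /\ H (s, 1) = c 0).

(** ** Smooth Jordan domains *)

(** A closed curve is a 1-periodic map on the line, so that smoothness
    includes the closing point; [gamma' <> 0] makes the image a smooth curve. *)
Definition smooth_jordan_param (gamma : R -> C) : Prop :=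
  (forall n t, ex_derive_n (fun s => Re (gamma s)) n t) /\
  (forall n t, ex_derive_n (fun s => Im (gamma s)) n t) /\
  (forall t, gamma (t + 1) = gamma t) /\
  (forall s t, 0 <= s < 1 -> 0 <= t < 1 -> gamma s = gamma t -> s = t) /\
  (forall t, (Derive (fun s => Re (gamma s)) t,
              Derive (fun s => Im (gamma s)) t) <> RtoC 0).

Definition smooth_jordan_curve (A : C -> Prop) : Prop :=
  exists gamma : R -> C, smooth_jordan_param gamma /\
    forall z, A z <-> exists t, gamma t = z.

Definition smooth_jordan_domain (Omega : C -> Prop) : Prop :=
  domain Omega /\ bounded Omega /\ simply_connected Omega /\
  smooth_jordan_curve (boundary Omega).

(** ** Partial derivatives of complex-valued functions *)

Inductive axis : Set := axis_x | axis_y.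

Definition slice (a : axis) (z : C) (t : R) : C :=
  match a with axis_x => (t, Im z) | axis_y => (Re z, t) end.

Definition coord (a : axis) (z : C) : R :=
  match a with axis_x => Re z | axis_y => Im z end.

Definition ex_partial (a : axis) (f : C -> C) (z : C) : Prop :=
  ex_derive (fun t => Re (f (slice a z t))) (coord a z) /\
  ex_derive (fun t => Im (f (slice a z t))) (coord a z).

Definition partial (a : axis) (f : C -> C) (z : C) : C :=
  (Derive (fun t => Re (f (slice a z t))) (coord a z),
   Derive (fun t => Im (f (slice a z t))) (coord a z)).

(** Derivatives of all orders are indexed by words in the two axes, the last
    letter being applied first. *)
Fixpoint partials (w : list axis) (f : C -> C) : C -> C :=
  match w with
  | nil => f
  | a :: w' => partial a (partials w' f)
  end.

Definition dbar (f : C -> C) (z : C) : C :=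
  (/ RtoC 2 * (partial axis_x f z + Ci * partial axis_y f z))%C.

(** ** Spaces of smooth functions *)

(** To be used with [D] open. *)
Definition smooth_on (D : C -> Prop) (f : C -> C) : Prop :=
  forall w z, D z ->
    continuous (partials w f) z /\ forall a, ex_partial a (partials w f) z.

Definition smooth (f : C -> C) : Prop := smooth_on (fun _ => True) f.

Definition continuous_extension (Omega : C -> Prop) (g h : C -> C) : Prop :=
  continuous_on (closure Omega) h /\ forall z, Omega z -> h z = g z.

(** Smoothness up to the boundary: all partial derivatives in the open set
    [Omega] extend continuously to its closure, [f] itself being the extension
    of order 0. The values of [f] off the closure play no role. *)
Definition smooth_closure (Omega : C -> Prop) (f : C -> C) : Prop :=
  smooth_on Omega f /\ continuous_on (closure Omega) f /\
  forall w, exists h, continuous_extension Omega (partials w f) h.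

Definition vanishes_on (A : C -> Prop) (f : C -> C) : Prop :=
  forall z, A z -> f z = RtoC 0.

(** ** Agreement up to infinite order *)

(** For functions on the closure, a derivative at a boundary point is the value
    there of the continuous extension of the derivative from [Omega]. *)
Definition agree_infinite_order_closure (Omega : C -> Prop) (f g : C -> C)
  : Prop :=
  forall w, exists h,
    continuous_extension Omega (partials w (fun z => (f z - g z)%C)) h /\
    vanishes_on (boundary Omega) h.

Definition agree_infinite_order (A : C -> Prop) (f g : C -> C) : Prop :=
  forall w, vanishes_on A (partials w (fun z => (f z - g z)%C)).

(* Main.v *)
Require Import Defs.
From Stdlib Require Import Reals.
From Coquelicot Require Import Coquelicot.
From Stdlib Require Import ssreflect ZArith Lra Lia List Classical ClassicalEpsilon.
Open Scope R_scope.

(** The equation is first solved as a formal power series transverse to the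
    curve. Let [rho] be a smooth function of bounded support that vanishes on the
    curve and for which [dbar rho] is positive there, and let [sigma] be a
    smooth function with [sigma * dbar rho = 1] near the curve. By the Leibniz
    rule, [dbar (rho ^ (k + 1) * u)] is
    [(k + 1) * rho ^ k * dbar rho * u + rho ^ (k + 1) * dbar u], so that the
    sum of the [rho ^ (k + 1) * u k] with [u 0 = sigma * U] and
    [u (k + 1) = - sigma * dbar (u k) / (k + 2)] solves the equation up to
    arbitrarily high powers of [rho] ([dbar_formal_sum]). This sum need not
    converge. As in the lemma of Borel, its [k]-th term is multiplied by a
    cutoff function of [Cmod rho ^ 2 / eps ^ 2], equal to [1] near the curve,
    with [eps] depending on [k]: since the term vanishes to order [k + 1] along
    the curve, its derivatives up to order [k] become small with [eps]
    ([jet_localised]), and for suitable scales the series can be differentiated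
    term by term ([jet_sum_series]). Near the curve its sum differs from a
    partial sum of the formal solution by a function that vanishes to high
    order, which gives agreement to infinite order ([residual_jet]).

    All this takes place on an open set [D], with functions all of whose
    derivatives extend continuously to the closure. Part (i) is the case in
    which [D] is the domain, part (ii) the case in which it is the whole plane.

    The defining function [rho] ([defining_function]) is patched together
    along the curve. Near each of its points the curve is a graph over one of the
    axes, hence the zero set of a real function [rho0] such as [y - g x] whose
    [dbar] does not vanish. The product of [rho0] with the conjugate of
    [dbar rho0] and with a bump function has a nonnegative [dbar] along the
    curve, positive near the given point; sums of such functions, finitely many
    by compactness, keep these properties. Complex values of [rho] are allowed,
    which is why the local pieces need not be oriented coherently. *)

(** * Smooth functions of one real variable *)

(** The successive derivatives are given as witnesses: closure under an
    operation is then one induction on [N], in which only the formula for the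
    first derivative occurs. *)
Fixpoint derivable_times (N : nat) (f : R -> R) : Prop :=
  match N with
  | O => True
  | S N' => exists g, (forall x, is_derive f x (g x)) /\ derivable_times N' g
  end.

Definition smooth1 (f : R -> R) : Prop := forall N, derivable_times N f.

Lemma derivable_times_ext N : forall f g,
  (forall x, f x = g x) -> derivable_times N f -> derivable_times N g.
Proof.
destruct N as [|N]; simpl; intros f g H Hf; [easy|].
destruct Hf as [h [H1 H2]]; exists h; split; [|easy].
intros x; apply (is_derive_ext f); auto.
Qed.

Lemma derivable_times_pred N : forall f,
  derivable_times (S N) f -> derivable_times N f.
Proof.
induction N as [|N IH]; intros f; [easy|].
intros [g [H1 H2]]; exists g; split; [easy|]; apply IH, H2.
Qed.

Lemma derivable_times_plus N : forall f g,
  derivable_times N f -> derivable_times N g ->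
  derivable_times N (fun x => f x + g x).
Proof.
induction N as [|N IH]; intros f g; [easy|].
intros [f' [F1 F2]] [g' [G1 G2]].
exists (fun x => f' x + g' x); split; [|now apply IH].
intros x; apply: is_derive_plus; auto.
Qed.

Lemma derivable_times_mult N : forall f g,
  derivable_times N f -> derivable_times N g ->
  derivable_times N (fun x => f x * g x).
Proof.
induction N as [|N IH]; intros f g; [easy|].
intros Hf Hg.
assert (Hf0 := derivable_times_pred _ _ Hf).
assert (Hg0 := derivable_times_pred _ _ Hg).
destruct Hf as [f' [F1 F2]]; destruct Hg as [g' [G1 G2]].
exists (fun x => f' x * g x + f x * g' x); split.
- intros x; apply: (is_derive_mult f g x _ _ (F1 x) (G1 x)); intros; apply Rmult_comm.
- apply derivable_times_plus; now apply IH.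
Qed.

Lemma derivable_times_comp N : forall f g,
  derivable_times N f -> derivable_times N g ->
  derivable_times N (fun x => f (g x)).
Proof.
induction N as [|N IH]; intros f g; [easy|].
intros Hf Hg.
assert (Hg0 := derivable_times_pred _ _ Hg).
destruct Hf as [f' [F1 F2]]; destruct Hg as [g' [G1 G2]].
exists (fun x => g' x * f' (g x)); split.
- intros x; apply: (is_derive_comp f g x _ _ (F1 (g x)) (G1 x)).
- apply derivable_times_mult; [easy | now apply IH].
Qed.

Lemma smooth1_const c : smooth1 (fun _ => c).
Proof.
intros N; revert c; induction N as [|N IH]; intros c; [easy|].
exists (fun _ => 0); split; [|apply IH].
intros x; apply: is_derive_const.
Qed.

Lemma smooth1_id : smooth1 (fun x => x).
Proof.
intros [|N]; [easy|]; exists (fun _ => 1); split; [|apply smooth1_const].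
intros x; apply: is_derive_id.
Qed.

Lemma smooth1_plus f g : smooth1 f -> smooth1 g -> smooth1 (fun x => f x + g x).
Proof. intros F G N; now apply derivable_times_plus. Qed.

Lemma smooth1_mult f g : smooth1 f -> smooth1 g -> smooth1 (fun x => f x * g x).
Proof. intros F G N; now apply derivable_times_mult. Qed.

Lemma smooth1_comp f g : smooth1 f -> smooth1 g -> smooth1 (fun x => f (g x)).
Proof. intros F G N; now apply derivable_times_comp. Qed.

Lemma smooth1_ext f g : (forall x, f x = g x) -> smooth1 f -> smooth1 g.
Proof. intros H F N; now apply (derivable_times_ext N f). Qed.

Lemma smooth1_affine a b : smooth1 (fun x => a * x + b).
Proof.
apply smooth1_plus; [apply smooth1_mult; [|apply smooth1_id]|]; apply smooth1_const.
Qed.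

Lemma smooth1_is_derive f : smooth1 f -> forall x, is_derive f x (Derive f x).
Proof.
intros H x; destruct (H 1%nat) as [g [H1 _]].
apply Derive_correct; exists (g x); apply H1.
Qed.

Lemma smooth1_Derive f : smooth1 f -> smooth1 (Derive f).
Proof.
intros H N; destruct (H (S N)) as [g [H1 H2]].
apply (derivable_times_ext N g); [|easy].
intros x; symmetry; apply is_derive_unique, H1.
Qed.

Lemma smooth1_continuous f : smooth1 f -> forall x, continuous f x.
Proof.
intros H x; apply: ex_derive_continuous; exists (Derive f x); now apply smooth1_is_derive.
Qed.

Lemma smooth1_of_Derive f g :
  (forall x, is_derive f x (g x)) -> smooth1 g -> smooth1 f.
Proof. intros H G [|N]; [easy|]; exists g; split; [easy|apply G]. Qed.

Lemma smooth1_of_ex_derive_n f :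
  (forall n x, ex_derive_n f n x) -> smooth1 f.
Proof.
intros H N.
cut (forall k, derivable_times N (Derive_n f k)); [intros K; apply (K 0%nat)|].
induction N as [|N IH]; intros k; [easy|].
exists (Derive_n f (S k)); split; [|apply IH].
intros x; apply Derive_correct, (H (S k) x).
Qed.

Lemma smooth1_inv f : (forall x, f x <> 0) -> smooth1 f -> smooth1 (fun x => / f x).
Proof.
intros H F N; induction N as [|N IH]; [easy|].
exists (fun x => (-1 * Derive f x) * (/ f x * / f x)); split.
- intros x.
  replace (-1 * Derive f x * (/ f x * / f x)) with (- Derive f x / (f x) ^ 2)
    by (field; auto).
  apply is_derive_inv; [now apply smooth1_is_derive | auto].
- apply derivable_times_mult; [|now apply derivable_times_mult].
  apply derivable_times_mult; [apply smooth1_const | now apply smooth1_Derive].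
Qed.

(** * A smooth cutoff *)

Lemma is_derive_of_quadratic_bound (f : R -> R) (M : R) :
  (forall x, Rabs (f x) <= M * x ^ 2) -> is_derive f 0 0.
Proof.
intros H.
assert (HM : 0 <= M).
{ generalize (H 1) (Rabs_pos (f 1)); lra. }
assert (f0 : f 0 = 0).
{ generalize (H 0) (Rabs_pos (f 0)); intros.
  destruct (Req_dec (f 0) 0) as [E|E]; [easy|].
  apply Rabs_pos_lt in E; simpl in *; lra. }
apply is_derive_Reals; intros eps Heps.
assert (Hd : 0 < eps / (M + 1)) by (apply Rdiv_lt_0_compat; lra).
exists (mkposreal _ Hd); intros h h0 Hh; simpl in Hh.
rewrite Rplus_0_l f0 !Rminus_0_r /Rdiv Rabs_mult Rabs_inv.
assert (Hp : 0 < Rabs h) by now apply Rabs_pos_lt.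
apply Rle_lt_trans with (M * Rabs h).
- apply Rle_trans with (M * h ^ 2 * / Rabs h).
  + apply Rmult_le_compat_r; [apply Rlt_le, Rinv_0_lt_compat, Hp | apply H].
  + rewrite -(pow2_abs h); right; field; lra.
- apply Rle_lt_trans with ((M + 1) * Rabs h); [nra|].
  apply Rlt_le_trans with ((M + 1) * (eps / (M + 1))).
  + apply Rmult_lt_compat_l; lra.
  + right; field; lra.
Qed.

(** Raise [exp (y / m) >= y / m] to the power [m]. *)
Lemma pow_exp_opp_le m y : 0 <= y -> y ^ m * exp (- y) <= INR m ^ m.
Proof.
intros Hy; destruct m as [|m].
{ simpl; rewrite Rmult_1_l -exp_0; destruct (Req_dec y 0) as [->|E].
  - rewrite Ropp_0; lra.
  - apply Rlt_le, exp_increasing; lra. }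
assert (Hm : 0 < INR (S m)) by (apply lt_0_INR; lia).
assert (Hq : 0 <= y / INR (S m)) by (apply Rdiv_le_0_compat; lra).
assert (E : (y / INR (S m)) ^ S m <= exp y).
{ replace (exp y) with (exp (y / INR (S m)) ^ S m).
  - apply pow_incr; split; [easy|].
    generalize (exp_ineq1_le (y / INR (S m))); lra.
  - assert (P : forall n x, exp x ^ n = exp (INR n * x)).
    { intros n x; induction n as [|n IH].
      - now rewrite Rmult_0_l exp_0.
      - rewrite S_INR Rmult_plus_distr_r exp_plus -IH Rmult_1_l; simpl; ring. }
    rewrite P; f_equal; field; lra. }
rewrite exp_Ropp.
assert (He := exp_pos y).
apply Rmult_le_reg_r with (exp y); [easy|].
rewrite Rmult_assoc Rinv_l ?Rmult_1_r; try lra.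
replace y with (INR (S m) * (y / INR (S m))) at 1 by (field; lra).
rewrite Rpow_mult_distr; apply Rmult_le_compat_l; [apply pow_le; lra | easy].
Qed.

(** The derivatives of [exp (- / x)], extended by [0] to [x <= 0], are linear
    combinations of these functions; treating the whole family at once makes
    the smoothness of each an induction. *)
Definition flat_term (n : nat) (x : R) : R :=
  match Rlt_dec 0 x with
  | left _ => (/ x) ^ n * exp (- / x)
  | right _ => 0
  end.

Lemma flat_term_pos n x : 0 < x -> flat_term n x = (/ x) ^ n * exp (- / x).
Proof. unfold flat_term; destruct (Rlt_dec 0 x); [easy|lra]. Qed.

Lemma flat_term_nonpos n x : x <= 0 -> flat_term n x = 0.
Proof. unfold flat_term; destruct (Rlt_dec 0 x); [lra|easy]. Qed.

Lemma flat_term_quadratic_bound n x :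
  Rabs (flat_term n x) <= INR (n + 2) ^ (n + 2) * x ^ 2.
Proof.
destruct (Rle_lt_dec x 0) as [H|H].
{ rewrite flat_term_nonpos ?Rabs_R0 //.
  apply Rmult_le_pos; [apply pow_le, pos_INR | apply pow2_ge_0]. }
assert (Hi : 0 < / x) by now apply Rinv_0_lt_compat.
rewrite flat_term_pos // Rabs_right.
2: { apply Rle_ge, Rmult_le_pos; [apply pow_le; lra | apply Rlt_le, exp_pos]. }
assert (E := pow_exp_opp_le (n + 2) (/ x) (Rlt_le _ _ Hi)).
replace ((/ x) ^ n * exp (- / x)) with ((/ x) ^ (n + 2) * exp (- / x) * x ^ 2).
- apply Rmult_le_compat_r; [apply pow2_ge_0 | easy].
- rewrite pow_add; simpl; field; lra.
Qed.

(** At the origin the quadratic bound gives the derivative [0]. *)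
Lemma is_derive_flat_term n x :
  is_derive (flat_term n) x (- INR n * flat_term (S n) x + flat_term (n + 2) x).
Proof.
destruct (Rtotal_order x 0) as [H|[->|H]].
- rewrite !flat_term_nonpos; try lra.
  apply (is_derive_ext_loc (fun _ => 0)).
  + exists (mkposreal (- x) ltac:(lra)); intros y Hy.
    apply Rabs_lt_between in Hy; unfold minus, plus, opp in Hy; simpl in Hy.
    rewrite flat_term_nonpos //; lra.
  + replace (- INR n * 0 + 0) with 0 by ring; apply: is_derive_const.
- rewrite !flat_term_nonpos; try lra.
  replace (- INR n * 0 + 0) with 0 by ring.
  apply (is_derive_of_quadratic_bound _ (INR (n + 2) ^ (n + 2))).
  apply flat_term_quadratic_bound.
- rewrite !flat_term_pos //.
  apply (is_derive_ext_loc (fun y => (/ y) ^ n * exp (- / y))).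
  + exists (mkposreal x H); intros y Hy.
    apply Rabs_lt_between in Hy; unfold minus, plus, opp in Hy; simpl in Hy.
    rewrite flat_term_pos //; lra.
  + auto_derive; [repeat split; lra|].
    rewrite pow_add; destruct n as [|n]; simpl pred; [simpl; field; lra|].
    rewrite !S_INR; simpl pow; field; lra.
Qed.

Lemma smooth1_flat_term n : smooth1 (flat_term n).
Proof.
intros N; revert n; induction N as [|N IH]; intros n; [easy|].
eexists; split; [intros x; apply is_derive_flat_term|].
apply derivable_times_plus; [|apply IH].
apply derivable_times_mult; [apply smooth1_const | apply IH].
Qed.

Lemma flat_term_0_pos x : 0 < x -> 0 < flat_term 0 x.
Proof. intros H; rewrite flat_term_pos //= Rmult_1_l; apply exp_pos. Qed.

Definition cutoff (s : R) : R :=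
  flat_term 0 (1 - s) * / (flat_term 0 (1 - s) + flat_term 0 (s - 1 / 2)).

Lemma flat_term_0_ge x : 0 <= flat_term 0 x.
Proof.
destruct (Rle_lt_dec x 0) as [H|H]; [rewrite flat_term_nonpos //; lra|].
apply Rlt_le, flat_term_0_pos, H.
Qed.

Lemma cutoff_denominator_pos s : 0 < flat_term 0 (1 - s) + flat_term 0 (s - 1 / 2).
Proof.
destruct (Rlt_le_dec s 1) as [H|H].
- assert (A := flat_term_0_pos (1 - s)); assert (B := flat_term_0_ge (s - 1 / 2)); lra.
- assert (A := flat_term_0_pos (s - 1 / 2)); assert (B := flat_term_0_ge (1 - s)); lra.
Qed.

Lemma smooth1_cutoff : smooth1 cutoff.
Proof.
assert (A : smooth1 (fun s => flat_term 0 (1 - s))).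
{ apply (smooth1_comp (flat_term 0)); [apply smooth1_flat_term|].
  apply (smooth1_ext (fun s => -1 * s + 1)); [intros; ring | apply smooth1_affine]. }
apply smooth1_mult; [easy|].
apply smooth1_inv; [intros s; generalize (cutoff_denominator_pos s); lra|].
apply smooth1_plus; [easy|].
apply (smooth1_comp (flat_term 0)); [apply smooth1_flat_term|].
apply (smooth1_ext (fun s => 1 * s + - (1 / 2))); [intros; lra | apply smooth1_affine].
Qed.

Lemma cutoff_eq1 s : s <= 1 / 2 -> cutoff s = 1.
Proof.
intros H; unfold cutoff; rewrite (flat_term_nonpos 0 (s - 1 / 2)); try lra.
assert (A := flat_term_0_pos (1 - s)); field; lra.
Qed.

Lemma cutoff_eq0 s : 1 <= s -> cutoff s = 0.
Proof. intros H; unfold cutoff; rewrite flat_term_nonpos; lra. Qed.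

Lemma cutoff_ge0 s : 0 <= cutoff s.
Proof.
apply Rmult_le_pos; [apply flat_term_0_ge|].
apply Rlt_le, Rinv_0_lt_compat, cutoff_denominator_pos.
Qed.

Lemma cutoff_le1 s : cutoff s <= 1.
Proof.
assert (A := cutoff_denominator_pos s); assert (B := flat_term_0_ge (s - 1 / 2)).
unfold cutoff; apply Rmult_le_reg_r with (1 := A); rewrite Rmult_assoc Rinv_l; lra.
Qed.

(** * Smooth inverses and graphs *)

Lemma is_derive_continuity_pt (f : R -> R) x l : is_derive f x l -> continuity_pt f x.
Proof.
intros H; apply continuity_pt_filterlim.
apply: (ex_derive_continuous f x); now exists l.
Qed.

Lemma smooth1_primitive f a b : smooth1 f ->
  exists F, F a = b /\ smooth1 F /\ forall x, is_derive F x (f x).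
Proof.
intros Hf.
assert (HD : forall x, is_derive (fun x => RInt f a x + b) x (f x)).
{ intros x; rewrite -[f x]Rplus_0_r; apply: is_derive_plus; [|apply: is_derive_const].
  apply: (is_derive_RInt f _ a); [|now apply smooth1_continuous].
  exists (mkposreal 1 Rlt_0_1); intros y _; apply: RInt_correct.
  apply ex_RInt_continuous; intros; now apply smooth1_continuous. }
exists (fun x => RInt f a x + b); split; [rewrite RInt_point; apply Rplus_0_l|].
split; [now apply (smooth1_of_Derive _ f) | easy].
Qed.

Section Inverse.
Variables (G G' : R -> R) (c : R).
Hypothesis c0 : 0 < c.
Hypothesis HG : forall x, is_derive G x (G' x).
Hypothesis Hc : forall x, c <= G' x.

Lemma expanding_increment s t : s <= t -> c * (t - s) <= G t - G s.
Proof.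
intros H; destruct (MVT_gen G s t G') as [x [_ ->]].
- intros; apply HG.
- intros x _; now apply (is_derive_continuity_pt _ _ (G' x)).
- apply Rmult_le_compat_r; [lra | apply Hc].
Qed.

Lemma expanding_Rabs s t : c * Rabs (t - s) <= Rabs (G t - G s).
Proof.
destruct (Rle_dec s t) as [H|H].
- assert (E := expanding_increment s t H).
  rewrite !Rabs_pos_eq; [easy| |lra].
  apply Rle_trans with (2 := E), Rmult_le_pos; lra.
- assert (E := expanding_increment t s ltac:(lra)).
  rewrite (Rabs_minus_sym t) (Rabs_minus_sym (G t)) !Rabs_pos_eq; [easy| |lra].
  apply Rle_trans with (2 := E), Rmult_le_pos; lra.
Qed.

Lemma expanding_surjective x : {t | G t = x}.
Proof.
pose (M := Rabs (x - G 0) / c).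
assert (HM : 0 <= M) by (apply Rdiv_le_0_compat; [apply Rabs_pos|easy]).
assert (EM : c * M = Rabs (x - G 0)) by (unfold M; field; lra).
assert (A := expanding_increment 0 M HM).
assert (B := expanding_increment (- M) 0 ltac:(lra)).
assert (D := Rle_abs (x - G 0)); assert (D' := Rle_abs (- (x - G 0))).
rewrite Rabs_Ropp in D'.
destruct (IVT_cor (fun t => G t - x) (- M) M) as [t [_ Ht]].
- intros t; apply (is_derive_continuity_pt _ _ (G' t - 0)).
  apply: (is_derive_minus G (fun _ => x)); [apply HG | apply: is_derive_const].
- lra.
- nra.
- exists t; lra.
Qed.

(** A map of the line that expands distances at least by a factor [c > 0] has
    a Lipschitz inverse, whose derivative [/ G' (tau x)] is as many times
    derivable as [tau] itself. *)
Lemma smooth1_inverse : smooth1 G' ->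
  exists tau, smooth1 tau /\ forall t, tau (G t) = t.
Proof.
intros SG.
pose (tau x := proj1_sig (expanding_surjective x)).
assert (Et : forall x, G (tau x) = x) by (intros x; unfold tau; now destruct expanding_surjective).
assert (Lip : forall x y, Rabs (tau y - tau x) <= / c * Rabs (y - x)).
{ intros x y; assert (E := expanding_Rabs (tau x) (tau y)); rewrite !Et in E.
  apply Rmult_le_reg_l with c; [easy|]; rewrite -Rmult_assoc Rinv_r; lra. }
assert (HD : forall x, is_derive tau x (/ G' (tau x))).
{ intros x; assert (HGx := HG (tau x)).
  assert (Hg : 0 < G' (tau x)) by (generalize (Hc (tau x)); lra).
  apply is_derive_Reals in HGx; apply is_derive_Reals; intros eps Heps.
  (* The difference quotients of [tau] and of [G] are inverse to each other. *)
  assert (Heps' : 0 < eps * (c * G' (tau x))) by (repeat apply Rmult_lt_0_compat; lra).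
  destruct (HGx _ Heps') as [d Hd].
  assert (Hd' : 0 < c * d) by (apply Rmult_lt_0_compat; [easy | apply cond_pos]).
  exists (mkposreal _ Hd'); intros h h0 Hh; simpl in Hh.
  pose (k := tau (x + h) - tau x).
  assert (Ek : G (tau x + k) = x + h).
  { unfold k; replace (tau x + (tau (x + h) - tau x)) with (tau (x + h)) by ring; apply Et. }
  assert (k0 : k <> 0).
  { intros E; rewrite E Rplus_0_r Et in Ek; lra. }
  assert (Lk : c * Rabs k <= Rabs h).
  { assert (E := Lip x (x + h)); replace (x + h - x) with h in E by ring; fold k in E.
    apply Rmult_le_reg_l with (/ c); [now apply Rinv_0_lt_compat|].
    rewrite -Rmult_assoc Rinv_l; lra. }
  assert (Hk : Rabs k < d).
  { apply Rmult_lt_reg_l with c; [easy|]; lra. }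
  specialize (Hd k k0 Hk); rewrite Ek Et in Hd.
  replace (x + h - x) with h in Hd by ring.
  fold k.
  replace (k / h - / G' (tau x)) with (- (h / k - G' (tau x)) * (k / h * / G' (tau x)))
    by (field; repeat split; try lra).
  rewrite Rabs_mult Rabs_Ropp.
  assert (Q : Rabs (k / h * / G' (tau x)) <= / (c * G' (tau x))).
  { rewrite Rabs_mult Rabs_inv (Rabs_pos_eq (G' _)); [|lra].
    rewrite Rinv_mult; apply Rmult_le_compat_r; [apply Rlt_le, Rinv_0_lt_compat; lra|].
    unfold Rdiv; rewrite Rabs_mult Rabs_inv.
    assert (Hp : 0 < Rabs h) by now apply Rabs_pos_lt.
    apply Rmult_le_reg_l with (c * Rabs h); [now apply Rmult_lt_0_compat|].
    replace (c * Rabs h * (Rabs k * / Rabs h)) with (c * Rabs k) by (field; lra).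
    replace (c * Rabs h * / c) with (Rabs h) by (field; lra); easy. }
  apply Rle_lt_trans with (Rabs (h / k - G' (tau x)) * / (c * G' (tau x))).
  - apply Rmult_le_compat_l; [apply Rabs_pos | easy].
  - apply Rmult_lt_reg_r with (c * G' (tau x)); [now apply Rmult_lt_0_compat|].
    rewrite Rmult_assoc Rinv_l; [lra|].
    apply Rgt_not_eq, Rmult_lt_0_compat; easy. }
exists tau; split.
- intros N; induction N as [|N IH]; [easy|].
  exists (fun x => / G' (tau x)); split; [easy|].
  apply (derivable_times_comp N (fun t => / G' t) tau); [|easy].
  apply smooth1_inv; [|easy]; intros t; generalize (Hc t); lra.
- intros t; assert (E := expanding_Rabs t (tau (G t))); rewrite Et in E.
  rewrite Rminus_diag Rabs_R0 in E.
  destruct (Req_dec (tau (G t)) t) as [|H]; [easy|].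
  assert (P := Rabs_pos_lt (tau (G t) - t) ltac:(lra)).
  generalize (Rmult_lt_0_compat _ _ c0 P); lra.
Qed.
End Inverse.

(** The inverse of [f1] near [t0] is extended to the whole line, which avoids
    all domain conditions: truncate the normalised slope of [f1] so that it
    stays between [1 / 2] and [3 / 2] without changing it near [t0]; its
    primitive is globally invertible and proportional to [f1] near [t0]. *)
Lemma locally_graph f1 f2 t0 : smooth1 f1 -> smooth1 f2 -> Derive f1 t0 <> 0 ->
  exists g delta, smooth1 g /\ 0 < delta /\
    forall t, Rabs (t - t0) < delta -> f2 t = g (f1 t).
Proof.
intros S1 S2 H0.
pose (c := Derive f1 t0).
pose (v t := Derive f1 t * / c - 1).
assert (Sv : smooth1 v).
{ apply (smooth1_plus (fun t => Derive f1 t * / c) (fun _ => -1)); [|apply smooth1_const].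
  apply smooth1_mult; [now apply smooth1_Derive | apply smooth1_const]. }
pose (slope t := v t * cutoff (4 * (v t * v t)) + 1).
assert (Ss : smooth1 slope).
{ apply smooth1_plus; [|apply smooth1_const]; apply smooth1_mult; [easy|].
  apply (smooth1_comp cutoff); [apply smooth1_cutoff|].
  apply smooth1_mult; [apply smooth1_const | now apply smooth1_mult]. }
assert (Bs : forall t, 1 / 2 <= slope t).
{ intros t; unfold slope; generalize (v t); intros u.
  destruct (Rle_dec 1 (4 * (u * u))) as [H|H].
  - rewrite cutoff_eq0; lra.
  - generalize (cutoff_ge0 (4 * (u * u))) (cutoff_le1 (4 * (u * u))).
    generalize (cutoff (4 * (u * u))); intros w W0 W1.
    assert (- (1 / 2) <= u <= 1 / 2) by nra; nra. }
destruct (smooth1_primitive slope t0 (f1 t0 / c) Ss) as [G [G0 [SG HG]]].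
destruct (smooth1_inverse G slope (1 / 2) ltac:(lra) HG Bs Ss) as [tau [St Ht]].
assert (v0 : v t0 = 0) by (unfold v; fold c; field; easy).
assert (Cv := smooth1_continuous v Sv t0).
destruct (proj1 (filterlim_locally v (v t0)) Cv (mkposreal (1 / 4) ltac:(lra))) as [d Hd].
exists (fun x => f2 (tau (x * / c))), d; split; [|split; [apply cond_pos|]].
- apply (smooth1_comp f2); [easy|]; apply (smooth1_comp tau); [easy|].
  apply smooth1_mult; [apply smooth1_id | apply smooth1_const].
- intros t Ht0; replace (f1 t * / c) with (G t); [now rewrite Ht|].
  destruct (MVT_cor4 (fun t => G t - f1 t * / c) (fun t => slope t - Derive f1 t * / c)
              t0 (Rabs (t - t0))) with (b := t) as [x [E Hx]]; [|lra|].
  + intros x _; apply: is_derive_minus; [apply HG|].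
    apply (is_derive_ext (fun t => / c * f1 t)); [intros; apply Rmult_comm|].
    rewrite Rmult_comm; apply is_derive_scal, smooth1_is_derive, S1.
  + assert (Sx : slope x = Derive f1 x * / c).
    { assert (Hb : ball t0 d x) by (apply: Rle_lt_trans Hx Ht0).
      specialize (Hd x Hb); rewrite v0 in Hd.
      apply Rabs_lt_between in Hd; unfold minus, plus, opp in Hd; simpl in Hd.
      unfold slope; rewrite cutoff_eq1; [unfold v; ring | nra]. }
    rewrite Sx Rminus_diag Rmult_0_l G0 in E; unfold Rdiv in E; lra.
Qed.

(** * Points of the plane and partial derivatives *)

Definition near (p : C) (d : R) (z : C) : Prop :=
  Rabs (Re z - Re p) < d /\ Rabs (Im z - Im p) < d.

(** A function satisfying this on [D] is continuous on [D], if [D] is open, and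
    extends continuously to the closure. Stating this through oscillations, and
    not through the extension, makes it obviously stable under uniform limits
    and under restriction. On the whole plane it is continuity. *)
Definition cauchy_at_closure (D : C -> Prop) (f : C -> C) : Prop :=
  forall p eps, 0 < eps -> exists d, 0 < d /\
    forall z z', D z -> D z' -> near p d z -> near p d z' -> Cmod (f z - f z') < eps.

(** Existence and value of a partial derivative in one predicate, so that
    the rules of calculus have no side conditions. *)
Definition is_partial (a : axis) (f : C -> C) (z l : C) : Prop :=
  is_derive (fun t => Re (f (slice a z t))) (coord a z) (Re l) /\
  is_derive (fun t => Im (f (slice a z t))) (coord a z) (Im l).

Definition everywhere (_ : C) : Prop := True.

Lemma C_ext (z w : C) : Re z = Re w -> Im z = Im w -> z = w.
Proof. destruct z, w; simpl; congruence. Qed.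

Lemma slice_coord a z : slice a z (coord a z) = z.
Proof. destruct a, z; easy. Qed.

Lemma slice_slice a z s t : slice a (slice a z s) t = slice a z t.
Proof. destruct a; easy. Qed.

Lemma coord_slice a z t : coord a (slice a z t) = t.
Proof. destruct a; easy. Qed.

Lemma near_slice a z t d : 0 < d -> Rabs (t - coord a z) < d -> near z d (slice a z t).
Proof. intros Hd H; destruct a; split; simpl in *; rewrite ?Rminus_diag ?Rabs_R0; easy. Qed.

Lemma near_center p d : 0 < d -> near p d p.
Proof. intros H; split; now rewrite Rminus_diag Rabs_R0. Qed.

Lemma near_le p d d' z : d <= d' -> near p d z -> near p d' z.
Proof. intros H [A B]; split; lra. Qed.

Lemma locally_near (z : C) (P : C -> Prop) :
  locally z P <-> exists d, 0 < d /\ forall w, near z d w -> P w.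
Proof.
split.
- intros [d Hd]; exists d; split; [apply cond_pos|].
  intros w [A B]; apply Hd; split; assumption.
- intros [d [H0 Hd]]; exists (mkposreal d H0); intros w [A B]; apply Hd; split; assumption.
Qed.

Lemma Cmod_le_sum z : Cmod z <= Rabs (Re z) + Rabs (Im z).
Proof.
unfold Cmod; apply Rsqr_incr_0_var.
2: { generalize (Rabs_pos (Re z)) (Rabs_pos (Im z)); lra. }
rewrite Rsqr_sqrt.
2: { generalize (pow2_ge_0 (fst z)) (pow2_ge_0 (snd z)); lra. }
rewrite -(pow2_abs (fst z)) -(pow2_abs (snd z)) /Rsqr.
generalize (Rabs_pos (Re z)) (Rabs_pos (Im z)); unfold Re, Im; nra.
Qed.

Lemma Rabs_Re_le z : Rabs (Re z) <= Cmod z.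
Proof. apply Rle_trans with (2 := Rmax_Cmod z), Rmax_l. Qed.

Lemma Rabs_Im_le z : Rabs (Im z) <= Cmod z.
Proof. apply Rle_trans with (2 := Rmax_Cmod z), Rmax_r. Qed.

Lemma is_partial_unique a f z l : is_partial a f z l -> partial a f z = l.
Proof.
intros [A B]; apply C_ext; unfold partial; simpl; now apply is_derive_unique.
Qed.

Lemma is_partial_ex a f z l : is_partial a f z l -> ex_partial a f z.
Proof. intros [A B]; split; eexists; eassumption. Qed.

Lemma is_partial_eq_near a f g z l d : 0 < d ->
  (forall w, near z d w -> f w = g w) -> is_partial a f z l -> is_partial a g z l.
Proof.
intros Hd H [A B]; split; [move: A | move: B]; apply is_derive_ext_loc;
  exists (mkposreal d Hd); intros t Ht; rewrite H //; now apply near_slice.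
Qed.

Lemma is_partial_const a c z : is_partial a (fun _ => c) z 0.
Proof. split; apply: is_derive_const. Qed.

Lemma is_partial_plus a f g z l m : is_partial a f z l -> is_partial a g z m ->
  is_partial a (fun w => f w + g w)%C z (l + m)%C.
Proof.
intros [A B] [A' B']; split.
- apply: (is_derive_plus _ _ _ _ _ A A').
- apply: (is_derive_plus _ _ _ _ _ B B').
Qed.

Lemma is_partial_mult a f g z l m : is_partial a f z l -> is_partial a g z m ->
  is_partial a (fun w => f w * g w)%C z (l * g z + f z * m)%C.
Proof.
intros [A B] [A' B'].
assert (M : forall (u v : R -> R) x du dv, is_derive u x du -> is_derive v x dv ->
   is_derive (fun t => u t * v t) x (du * v x + u x * dv)).
{ intros u v x du dv Hu Hv; apply: (is_derive_mult u v x du dv Hu Hv); apply Rmult_comm. }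
split.
- assert (E := is_derive_minus _ _ _ _ _ (M _ _ _ _ _ A A') (M _ _ _ _ _ B B')).
  rewrite slice_coord in E.
  replace (Re (l * g z + f z * m)) with
   (minus (Re l * Re (g z) + Re (f z) * Re m) (Im l * Im (g z) + Im (f z) * Im m)).
  + exact E.
  + unfold minus, plus, opp; simpl; unfold Re, Im; ring.
- assert (E := is_derive_plus _ _ _ _ _ (M _ _ _ _ _ A B') (M _ _ _ _ _ B A')).
  rewrite slice_coord in E.
  replace (Im (l * g z + f z * m)) with
   (plus (Re l * Im (g z) + Re (f z) * Im m) (Im l * Re (g z) + Im (f z) * Re m)).
  + exact E.
  + unfold plus; simpl; unfold Re, Im; ring.
Qed.

Lemma is_partial_conj a f z l : is_partial a f z l ->
  is_partial a (fun w => Cconj (f w)) z (Cconj l).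
Proof. intros [A B]; split; [exact A | apply: (is_derive_opp _ _ _ B)]. Qed.

Definition real_comp (f : R -> R) (g : C -> C) (z : C) : C := RtoC (f (Re (g z))).

Lemma is_partial_real_comp a f g z l m : is_derive f (Re (g z)) l -> is_partial a g z m ->
  is_partial a (real_comp f g) z (RtoC (Re m * l)).
Proof.
intros F [A _]; split; [|apply: is_derive_const].
apply: (is_derive_comp f (fun t => Re (g (slice a z t)))); [now rewrite slice_coord | exact A].
Qed.

Definition kronecker (a b : axis) : C :=
  match a, b with axis_x, axis_x | axis_y, axis_y => 1 | _, _ => 0 end.

Lemma is_partial_coordinate a b z :
  is_partial a (fun w => RtoC (coord b w)) z (kronecker a b).
Proof.
split; destruct a, b; simpl; try apply: is_derive_const; apply: is_derive_id.
Qed.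

(** * Functions that extend continuously to the closure *)

Lemma cauchy_sub (D D' : C -> Prop) f : (forall z, D' z -> D z) ->
  cauchy_at_closure D f -> cauchy_at_closure D' f.
Proof.
intros H F p eps He; destruct (F p eps He) as [d [Hd Hf]].
exists d; split; auto.
Qed.

Lemma cauchy_eq (D : C -> Prop) f g : (forall z, D z -> f z = g z) ->
  cauchy_at_closure D f -> cauchy_at_closure D g.
Proof.
intros H F p eps He; destruct (F p eps He) as [d [Hd Hf]].
exists d; split; [easy|]; intros z z' Dz Dz'; rewrite -(H z Dz) -(H z' Dz'); auto.
Qed.

Lemma cauchy_of_limits (D : C -> Prop) f l :
  (forall p eps, 0 < eps -> exists d, 0 < d /\
     forall z, D z -> near p d z -> Cmod (f z - l p) < eps) ->
  cauchy_at_closure D f.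
Proof.
intros H p eps He; destruct (H p (eps / 2) ltac:(lra)) as [d [Hd Hf]].
exists d; split; [easy|]; intros z z' Dz Dz' Hz Hz'.
replace (f z - f z')%C with ((f z - l p) + - (f z' - l p))%C by ring.
apply Rle_lt_trans with (1 := Cmod_triangle _ _); rewrite Cmod_opp.
generalize (Hf z Dz Hz) (Hf z' Dz' Hz'); lra.
Qed.

Lemma cauchy_const D c : cauchy_at_closure D (fun _ => c).
Proof.
intros p eps He; exists 1; split; [lra|]; intros.
replace (c - c)%C with (RtoC 0) by ring; now rewrite Cmod_0.
Qed.

Lemma cauchy_coordinate D b : cauchy_at_closure D (fun w => RtoC (coord b w)).
Proof.
apply (cauchy_of_limits _ _ (fun w => RtoC (coord b w))); intros p eps He.
exists eps; split; [easy|]; intros z _ [A B].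
rewrite -RtoC_minus Cmod_R; now destruct b.
Qed.

Lemma cauchy_plus D f g : cauchy_at_closure D f -> cauchy_at_closure D g ->
  cauchy_at_closure D (fun z => f z + g z)%C.
Proof.
intros F G p eps He.
destruct (F p (eps / 2) ltac:(lra)) as [d [Hd Hf]].
destruct (G p (eps / 2) ltac:(lra)) as [e [H0 Hg]].
exists (Rmin d e); split; [now apply Rmin_glb_lt|]; intros z z' Dz Dz' Hz Hz'.
replace (f z + g z - (f z' + g z'))%C with ((f z - f z') + (g z - g z'))%C by ring.
apply Rle_lt_trans with (1 := Cmod_triangle _ _).
assert (A := Hf z z' Dz Dz' (near_le _ _ _ _ (Rmin_l _ _) Hz) (near_le _ _ _ _ (Rmin_l _ _) Hz')).
assert (B := Hg z z' Dz Dz' (near_le _ _ _ _ (Rmin_r _ _) Hz) (near_le _ _ _ _ (Rmin_r _ _) Hz')).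
lra.
Qed.

Lemma cauchy_locally_bounded D f p : cauchy_at_closure D f ->
  exists d c, 0 < d /\ 0 < c /\ forall z, D z -> near p d z -> Cmod (f z) <= c.
Proof.
intros F; destruct (F p 1 Rlt_0_1) as [d [Hd Hf]].
destruct (classic (exists w, D w /\ near p d w)) as [[w [Dw Hw]]|H].
- exists d, (1 + Cmod (f w)); split; [easy|]; split; [generalize (Cmod_ge_0 (f w)); lra|].
  intros z Dz Hz; replace (f z) with ((f z - f w) + f w)%C by ring.
  apply Rle_trans with (1 := Cmod_triangle _ _); generalize (Hf z w Dz Dw Hz Hw); lra.
- exists d, 1; repeat split; try lra; intros z Dz Hz; case: H; exists z; now split.
Qed.

Lemma cauchy_mult D f g : cauchy_at_closure D f -> cauchy_at_closure D g ->
  cauchy_at_closure D (fun z => f z * g z)%C.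
Proof.
intros F G p eps He.
destruct (cauchy_locally_bounded D f p F) as [d1 [c1 [P1 [Q1 H1]]]].
destruct (cauchy_locally_bounded D g p G) as [d2 [c2 [P2 [Q2 H2]]]].
assert (E1 : 0 < eps / (2 * c2)) by (apply Rdiv_lt_0_compat; lra).
assert (E2 : 0 < eps / (2 * c1)) by (apply Rdiv_lt_0_compat; lra).
destruct (F p _ E1) as [d3 [P3 H3]]; destruct (G p _ E2) as [d4 [P4 H4]].
exists (Rmin (Rmin d1 d2) (Rmin d3 d4)); split; [repeat apply Rmin_glb_lt; easy|].
intros z z' Dz Dz' Hz Hz'.
assert (L1 := Rle_trans _ _ _ (Rmin_l (Rmin d1 d2) (Rmin d3 d4)) (Rmin_l d1 d2)).
assert (L2 := Rle_trans _ _ _ (Rmin_l (Rmin d1 d2) (Rmin d3 d4)) (Rmin_r d1 d2)).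
assert (L3 := Rle_trans _ _ _ (Rmin_r (Rmin d1 d2) (Rmin d3 d4)) (Rmin_l d3 d4)).
assert (L4 := Rle_trans _ _ _ (Rmin_r (Rmin d1 d2) (Rmin d3 d4)) (Rmin_r d3 d4)).
replace (f z * g z - f z' * g z')%C with ((f z - f z') * g z + f z' * (g z - g z'))%C by ring.
apply Rle_lt_trans with (1 := Cmod_triangle _ _); rewrite !Cmod_mult.
assert (B1 := H1 z' Dz' (near_le _ _ _ _ L1 Hz')).
assert (B2 := H2 z Dz (near_le _ _ _ _ L2 Hz)).
assert (B3 := H3 z z' Dz Dz' (near_le _ _ _ _ L3 Hz) (near_le _ _ _ _ L3 Hz')).
assert (B4 := H4 z z' Dz Dz' (near_le _ _ _ _ L4 Hz) (near_le _ _ _ _ L4 Hz')).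
assert (N := Cmod_ge_0 (f z - f z')); assert (N' := Cmod_ge_0 (g z - g z')).
assert (X1 : Cmod (f z - f z') * Cmod (g z) <= Cmod (f z - f z') * c2) by (apply Rmult_le_compat_l; lra).
assert (X2 : Cmod (f z') * Cmod (g z - g z') <= c1 * Cmod (g z - g z')) by (apply Rmult_le_compat_r; lra).
assert (Y1 : Cmod (f z - f z') * c2 < eps / (2 * c2) * c2) by (apply Rmult_lt_compat_r; lra).
assert (Y2 : c1 * Cmod (g z - g z') < c1 * (eps / (2 * c1))) by (apply Rmult_lt_compat_l; lra).
replace (eps / (2 * c2) * c2) with (eps / 2) in Y1 by (field; lra).
replace (c1 * (eps / (2 * c1))) with (eps / 2) in Y2 by (field; lra).
lra.
Qed.

Lemma cauchy_conj D f : cauchy_at_closure D f -> cauchy_at_closure D (fun z => Cconj (f z)).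
Proof.
intros F p eps He; destruct (F p eps He) as [d [Hd Hf]].
exists d; split; [easy|]; intros z z' Dz Dz' Hz Hz'.
replace (Cconj (f z) - Cconj (f z'))%C with (Cconj (f z - f z')).
- rewrite Cmod_conj; auto.
- apply C_ext; simpl; ring.
Qed.

Lemma cauchy_real_comp f g : (forall x, continuous f x) ->
  cauchy_at_closure everywhere g -> cauchy_at_closure everywhere (real_comp f g).
Proof.
intros F G; apply (cauchy_of_limits _ _ (real_comp f g)); intros p eps He.
destruct (proj1 (filterlim_locally f _) (F (Re (g p))) (mkposreal eps He)) as [d Hd].
destruct (G p d (cond_pos d)) as [e [H0 He']].
exists e; split; [easy|]; intros z _ Hz.
unfold real_comp; rewrite -RtoC_minus Cmod_R.
apply Hd; apply: Rle_lt_trans (Rabs_Re_le _) (He' z p I I Hz (near_center _ _ H0)).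
Qed.

Lemma cauchy_uniform_limit D f :
  (forall eps, 0 < eps -> exists g, cauchy_at_closure D g /\
     forall z, D z -> Cmod (f z - g z) <= eps) ->
  cauchy_at_closure D f.
Proof.
intros H p eps He; destruct (H (eps / 4) ltac:(lra)) as [g [G Hg]].
destruct (G p (eps / 4) ltac:(lra)) as [d [Hd Hf]].
exists d; split; [easy|]; intros z z' Dz Dz' Hz Hz'.
replace (f z - f z')%C with ((f z - g z) + (- (f z' - g z') + (g z - g z')))%C by ring.
apply Rle_lt_trans with (1 := Cmod_triangle _ _).
assert (T := Cmod_triangle (- (f z' - g z')) (g z - g z')); rewrite Cmod_opp in T.
generalize (Hg z Dz) (Hg z' Dz') (Hf z z' Dz Dz' Hz Hz'); lra.
Qed.

(** Local boundedness and compactness: a neighbourhood of radius [d] is chosen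
    so small that [f] is bounded there by [/ d], and a lower bound for the
    radii needed to cover the box is an upper bound for [f]. *)
Lemma cauchy_bounded_on_boxes D f B : cauchy_at_closure D f ->
  exists c, forall z, D z -> Rabs (Re z) <= B -> Rabs (Im z) <= B -> Cmod (f z) <= c.
Proof.
intros F.
assert (L : forall p : C, exists d : posreal,
           forall z, D z -> near p d z -> Cmod (f z) <= / d).
{ intros p; destruct (cauchy_locally_bounded D f p F) as [d [c [Hd [Hc H]]]].
  assert (Hm : 0 < Rmin d (/ c)) by (apply Rmin_glb_lt; [easy | now apply Rinv_0_lt_compat]).
  exists (mkposreal _ Hm); simpl; intros z Dz Hz.
  apply Rle_trans with c; [apply H; [easy|]; apply (near_le _ _ _ _ (Rmin_l _ _) Hz)|].
  rewrite -{1}(Rinv_inv c); apply Rinv_le_contravar; [easy | apply Rmin_r]. }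
pose (delta u v := proj1_sig (constructive_indefinite_description _ (L (u, v)))).
destruct (compactness_value_2d (- B) B (- B) B delta) as [d Hd].
exists (/ d); intros z Dz Hr Hi; apply Rnot_lt_le; intros Hlt.
apply Rabs_le_between in Hr; apply Rabs_le_between in Hi.
apply (Hd (Re z) (Im z) Hr Hi); intros [u [v [_ [_ [Hu [Hv Hduv]]]]]].
unfold delta in *; destruct constructive_indefinite_description as [e He]; simpl in *.
assert (E := He z Dz (conj Hu Hv)).
assert (E' := Rinv_le_contravar _ _ (cond_pos d) Hduv); lra.
Qed.

(** * Orders of differentiability and of vanishing *)

(** [Q n] is meant as a regularity condition of order of vanishing [n], of which
    each derivative may lose one. With [Q] independent of [n] this is
    [N]-fold differentiability within a class of functions. *)
Fixpoint jet (D : C -> Prop) (Q : nat -> (C -> C) -> Prop) (N n : nat) (f : C -> C) : Prop :=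
  Q n f /\
  match N with
  | O => True
  | S N' => forall a, exists g,
      (forall z, D z -> is_partial a f z (g z)) /\ jet D Q N' (pred n) g
  end.

Lemma jet_head D Q N n f : jet D Q N n f -> Q n f.
Proof. destruct N; now intros [H _]. Qed.

Lemma jet_impl D D' Q Q' N : (forall z, D' z -> D z) ->
  (forall n f, Q n f -> Q' n f) ->
  forall n f, jet D Q N n f -> jet D' Q' N n f.
Proof.
intros HD H; induction N as [|N IH]; intros n f [Hf Hg]; split; auto.
intros a; destruct (Hg a) as [g [G1 G2]]; exists g; auto.
Qed.

Lemma jet_lower D Q N N' :
  (forall n m f, (m <= n)%nat -> Q n f -> Q m f) -> (N' <= N)%nat ->
  forall n m f, (m <= n)%nat -> jet D Q N n f -> jet D Q N' m f.
Proof.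
intros H; revert N; induction N' as [|N' IH]; intros [|N] HN n m f Hm [Hf Hg];
  try lia; split; try easy; try now apply (H n).
intros a; destruct (Hg a) as [g [G1 G2]]; exists g; split; [easy|].
apply (IH N) with (n := pred n); [lia | lia | easy].
Qed.

Lemma jet_plus D Q1 Q2 Q3 N :
  (forall n f g, Q1 n f -> Q2 n g -> Q3 n (fun z => f z + g z)%C) ->
  forall n f g, jet D Q1 N n f -> jet D Q2 N n g -> jet D Q3 N n (fun z => f z + g z)%C.
Proof.
intros H; induction N as [|N IH]; intros n f g [F F'] [G G']; split; auto.
intros a; destruct (F' a) as [f' [F1 F2]]; destruct (G' a) as [g' [G1 G2]].
exists (fun z => f' z + g' z)%C; split; [|auto].
intros z Dz; apply is_partial_plus; auto.
Qed.

(** Leibniz rule: orders of vanishing add up. *)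
Lemma jet_mult D Q1 Q2 Q3 N :
  (forall n m f, (m <= n)%nat -> Q1 n f -> Q1 m f) ->
  (forall n m f, (m <= n)%nat -> Q2 n f -> Q2 m f) ->
  (forall n m f, (m <= n)%nat -> Q3 n f -> Q3 m f) ->
  (forall n f g, Q3 n f -> Q3 n g -> Q3 n (fun z => f z + g z)%C) ->
  (forall n m f g, Q1 n f -> Q2 m g -> Q3 (n + m)%nat (fun z => f z * g z)%C) ->
  forall n m f g, jet D Q1 N n f -> jet D Q2 N m g ->
    jet D Q3 N (n + m)%nat (fun z => f z * g z)%C.
Proof.
intros L1 L2 L3 P M; induction N as [|N IH]; intros n m f g Hf Hg.
- destruct Hf, Hg; split; auto.
- assert (F0 := jet_lower _ _ _ N L1 (Nat.le_succ_diag_r N) n n f (le_n n) Hf).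
  assert (G0 := jet_lower _ _ _ N L2 (Nat.le_succ_diag_r N) m m g (le_n m) Hg).
  destruct Hf as [F F']; destruct Hg as [G G']; split; [auto|].
  intros a; destruct (F' a) as [f' [F1 F2]]; destruct (G' a) as [g' [G1 G2]].
  exists (fun z => f' z * g z + f z * g' z)%C; split.
  + intros z Dz; apply is_partial_mult; auto.
  + apply (jet_plus D Q3 Q3 Q3 N P).
    * apply (jet_lower D Q3 N N L3 (le_n N)) with (n := (pred n + m)%nat); [lia | auto].
    * apply (jet_lower D Q3 N N L3 (le_n N)) with (n := (n + pred m)%nat); [lia | auto].
Qed.

Definition open_plane (D : C -> Prop) : Prop :=
  forall z, D z -> exists d, 0 < d /\ forall w, near z d w -> D w.

Lemma open_plane_open D : open D -> open_plane D.
Proof. intros H z Dz; apply locally_near, H, Dz. Qed.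

Lemma open_plane_everywhere : open_plane everywhere.
Proof. intros z _; exists 1; split; [lra | easy]. Qed.

Lemma jet_eq D Q N : open_plane D ->
  (forall n f g, (forall z, D z -> f z = g z) -> Q n f -> Q n g) ->
  forall n f g, (forall z, D z -> f z = g z) -> jet D Q N n f -> jet D Q N n g.
Proof.
intros HD H; induction N as [|N IH]; intros n f g E [F F']; split; eauto.
intros a; destruct (F' a) as [f' [F1 F2]]; exists f'; split; [|easy].
intros z Dz; destruct (HD z Dz) as [d [Hd Hw]].
apply (is_partial_eq_near a f g z _ d Hd); auto.
Qed.

Lemma jet_is_partial D Q N n f a z :
  jet D Q (S N) n f -> D z -> is_partial a f z (partial a f z).
Proof.
intros [_ H] Dz; destruct (H a) as [g [G _]].
now rewrite (is_partial_unique a f z (g z) (G z Dz)); apply G.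
Qed.

Lemma jet_partial D Q N n f a : open_plane D ->
  (forall n f g, (forall z, D z -> f z = g z) -> Q n f -> Q n g) ->
  jet D Q (S N) n f -> jet D Q N (pred n) (partial a f).
Proof.
intros HD H [_ HJ]; destruct (HJ a) as [g [G J]].
apply (jet_eq D Q N HD H _ g); [|easy].
intros z Dz; symmetry; now apply is_partial_unique, G.
Qed.

Lemma jet_partials D Q w N n f : open_plane D ->
  (forall n f g, (forall z, D z -> f z = g z) -> Q n f -> Q n g) ->
  jet D Q (length w + N) n f -> jet D Q N (n - length w) (partials w f).
Proof.
intros HD H; revert N; induction w as [|a w IH]; intros N HJ; simpl in *.
- now rewrite Nat.sub_0_r.
- replace (n - S (length w))%nat with (pred (n - length w)) by lia.
  apply jet_partial; [easy|easy|]; apply IH; now rewrite Nat.add_succ_r.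
Qed.

(** * Functions smooth up to the closure *)

(** All derivatives on [D] extend continuously to the closure. Both function
    spaces of the problem are instances, for [D] the domain and [D] the plane. *)
Definition smooth_to_closure (D : C -> Prop) (f : C -> C) : Prop :=
  forall N, jet D (fun _ => cauchy_at_closure D) N 0 f.

Lemma smooth_const D c : smooth_to_closure D (fun _ => c).
Proof.
intros N; revert c; induction N as [|N IH]; intros c; split; auto using cauchy_const.
intros a; exists (fun _ => RtoC 0); split; [intros; apply is_partial_const | apply IH].
Qed.

Lemma smooth_coordinate D b : smooth_to_closure D (fun w => RtoC (coord b w)).
Proof.
intros [|N]; split; auto using cauchy_coordinate.
intros a; eexists; split; [intros; apply is_partial_coordinate | apply smooth_const].
Qed.

Lemma smooth_plus D f g : smooth_to_closure D f -> smooth_to_closure D g ->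
  smooth_to_closure D (fun z => f z + g z)%C.
Proof.
intros F G N; eapply jet_plus; [|apply F | apply G].
intros; now apply cauchy_plus.
Qed.

Lemma smooth_mult D f g : smooth_to_closure D f -> smooth_to_closure D g ->
  smooth_to_closure D (fun z => f z * g z)%C.
Proof.
intros F G N.
apply (jet_mult D (fun _ => cauchy_at_closure D) (fun _ => cauchy_at_closure D)
        (fun _ => cauchy_at_closure D) N) with (n := 0%nat) (m := 0%nat); auto;
  intros; now apply cauchy_plus || apply cauchy_mult.
Qed.

Lemma smooth_sub (D D' : C -> Prop) f : (forall z, D' z -> D z) ->
  smooth_to_closure D f -> smooth_to_closure D' f.
Proof.
intros H F N; apply (jet_impl D D' (fun _ => cauchy_at_closure D)); auto.
intros _ g; now apply cauchy_sub.
Qed.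

Lemma smooth_ext D (f g : C -> C) : (forall z, f z = g z) ->
  smooth_to_closure D f -> smooth_to_closure D g.
Proof.
intros E F N; specialize (F N); revert F.
assert (Q : forall (_ : nat) (u v : C -> C), (forall z, u z = v z) -> cauchy_at_closure D u -> cauchy_at_closure D v).
{ intros _ u v H; apply cauchy_eq; auto. }
destruct N as [|N]; intros [F1 F2]; split; try easy; try now apply (Q O f).
intros a; destruct (F2 a) as [h [H1 H2]]; exists h; split; [|easy].
intros z Dz; apply (is_partial_eq_near a f g z _ 1); auto; lra.
Qed.

Lemma smooth_scal D c f : smooth_to_closure D f -> smooth_to_closure D (fun z => c * f z)%C.
Proof. apply smooth_mult, smooth_const. Qed.

Lemma smooth_conj D f : smooth_to_closure D f -> smooth_to_closure D (fun z => Cconj (f z)).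
Proof.
intros F N; specialize (F N); revert f F; induction N as [|N IH]; intros f [F1 F2];
  split; auto using cauchy_conj.
intros a; destruct (F2 a) as [g [G1 G2]]; exists (fun z => Cconj (g z)); split; auto.
intros; apply is_partial_conj; auto.
Qed.

Lemma smooth_differentiable D f a z : smooth_to_closure D f -> D z ->
  is_partial a f z (partial a f z).
Proof. intros F; exact (jet_is_partial D _ 0 0 f a z (F 1%nat)). Qed.

Lemma smooth_partial D f a : open_plane D -> smooth_to_closure D f ->
  smooth_to_closure D (partial a f).
Proof.
intros HD F N; apply (jet_partial D _ N 0 f a HD); [|apply F].
intros _ u v; apply cauchy_eq.
Qed.

Lemma smooth_real_comp f g : smooth1 f -> smooth_to_closure everywhere g ->
  smooth_to_closure everywhere (real_comp f g).
Proof.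
intros F G N; revert f F; induction N as [|N IH]; intros f F; split; auto.
1, 2: apply cauchy_real_comp; [now apply smooth1_continuous | exact (jet_head _ _ _ _ _ (G O))].
intros a; exists (fun z => real_comp (fun x => x) (partial a g) z * real_comp (Derive f) g z)%C; split.
- intros z _; rewrite /real_comp -RtoC_mult; apply is_partial_real_comp.
  + now apply smooth1_is_derive.
  + now apply (smooth_differentiable everywhere).
- apply (jet_mult everywhere (fun _ => cauchy_at_closure everywhere)
        (fun _ => cauchy_at_closure everywhere)
        (fun _ => cauchy_at_closure everywhere) N) with (n := 0%nat) (m := 0%nat); auto;
  try (intros; now apply cauchy_plus || apply cauchy_mult).
  + apply (smooth_ext everywhere (fun z => / 2 * (partial a g z + Cconj (partial a g z)))%C).
    * intros z; apply C_ext; simpl; field.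
    * apply smooth_scal, smooth_plus; [|apply smooth_conj];
        now apply smooth_partial; [apply open_plane_everywhere|].
  + now apply IH, smooth1_Derive.
Qed.

Lemma smooth_pow D f n : smooth_to_closure D f -> smooth_to_closure D (fun z => Cpow (f z) n).
Proof.
intros F; induction n as [|n IH]; simpl; [apply smooth_const | now apply smooth_mult].
Qed.

(** * The Cauchy-Riemann operator *)

Lemma smooth_dbar D f : open_plane D -> smooth_to_closure D f -> smooth_to_closure D (dbar f).
Proof.
intros HD F; apply smooth_scal, smooth_plus; [|apply smooth_scal]; now apply smooth_partial.
Qed.

Lemma dbar_of_partials f z l m :
  is_partial axis_x f z l -> is_partial axis_y f z m -> dbar f z = (/ 2 * (l + Ci * m))%C.
Proof. intros A B; unfold dbar; now rewrite (is_partial_unique _ _ _ _ A) (is_partial_unique _ _ _ _ B). Qed.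

Definition differentiable_at (f : C -> C) (z : C) : Prop :=
  forall a, is_partial a f z (partial a f z).

Lemma dbar_plus f g z : differentiable_at f z -> differentiable_at g z ->
  dbar (fun w => f w + g w)%C z = (dbar f z + dbar g z)%C.
Proof.
intros F G; rewrite (dbar_of_partials (fun w => f w + g w)%C z _ _
   (is_partial_plus _ _ _ _ _ _ (F axis_x) (G axis_x)) (is_partial_plus _ _ _ _ _ _ (F axis_y) (G axis_y))).
unfold dbar; ring.
Qed.

Lemma dbar_mult f g z : differentiable_at f z -> differentiable_at g z ->
  dbar (fun w => f w * g w)%C z = (dbar f z * g z + f z * dbar g z)%C.
Proof.
intros F G; rewrite (dbar_of_partials (fun w => f w * g w)%C z _ _
   (is_partial_mult _ _ _ _ _ _ (F axis_x) (G axis_x)) (is_partial_mult _ _ _ _ _ _ (F axis_y) (G axis_y))).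
unfold dbar; ring.
Qed.

Lemma dbar_const c z : dbar (fun _ => c) z = 0.
Proof.
rewrite (dbar_of_partials _ z 0 0); [ring| |]; apply is_partial_const.
Qed.

Lemma partial_eq_near a f g z d : 0 < d -> (forall w, near z d w -> f w = g w) ->
  partial a f z = partial a g z.
Proof.
intros Hd H; unfold partial; f_equal; apply Derive_ext_loc;
  exists (mkposreal d Hd); intros t Ht; rewrite H //; now apply near_slice.
Qed.

Lemma dbar_eq_near f g z d : 0 < d -> (forall w, near z d w -> f w = g w) ->
  dbar f z = dbar g z.
Proof. intros Hd H; unfold dbar; now rewrite !(partial_eq_near _ f g z d Hd H). Qed.

Lemma smooth_differentiable_at D f z : smooth_to_closure D f -> D z -> differentiable_at f z.
Proof. intros F Dz a; now apply (smooth_differentiable D). Qed.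

Lemma smooth_everywhere_differentiable_at f z :
  smooth_to_closure everywhere f -> differentiable_at f z.
Proof. intros F; now apply (smooth_differentiable_at everywhere). Qed.

(** * Defining functions of a smooth Jordan curve *)

Section Curve.
Variable gamma : R -> C.
Hypothesis Hgamma : smooth_jordan_param gamma.

Lemma gamma_shift k t : gamma (t + IZR k) = gamma t.
Proof.
destruct Hgamma as [_ [_ [P _]]].
assert (N : forall n t, gamma (t + INR n) = gamma t).
{ induction n as [|n IH]; intros s; [now rewrite Rplus_0_r|].
  rewrite S_INR -Rplus_assoc P; apply IH. }
destruct (Z.le_gt_cases 0 k) as [H|H].
- rewrite -(Z2Nat.id k H) -INR_IZR_INZ; apply N.
- rewrite -(N (Z.to_nat (- k)) (t + IZR k)) INR_IZR_INZ Z2Nat.id; [|lia].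
  f_equal; rewrite opp_IZR; ring.
Qed.

Lemma shift_into a t : exists k, a <= t + IZR k < a + 1.
Proof.
exists (- Int_part (t - a))%Z; rewrite opp_IZR.
destruct (base_Int_part (t - a)); lra.
Qed.

Lemma gamma_injective s t : s < t < s + 1 -> gamma s <> gamma t.
Proof.
intros H E; destruct (shift_into 0 s) as [k Hk].
rewrite -(gamma_shift k s) -(gamma_shift k t) in E.
destruct Hgamma as [_ [_ [P [J _]]]].
destruct (Rlt_le_dec (t + IZR k) 1) as [L|L].
- generalize (J (s + IZR k) (t + IZR k) ltac:(lra) ltac:(lra) E); lra.
- assert (E' : gamma (t + IZR k - 1) = gamma (s + IZR k)).
  { rewrite E -(P (t + IZR k - 1)); f_equal; ring. }
  generalize (J (t + IZR k - 1) (s + IZR k) ltac:(lra) ltac:(lra) E'); lra.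
Qed.

Lemma smooth1_Re_gamma : smooth1 (fun s => Re (gamma s)).
Proof. apply smooth1_of_ex_derive_n, Hgamma. Qed.

Lemma smooth1_Im_gamma : smooth1 (fun s => Im (gamma s)).
Proof. apply smooth1_of_ex_derive_n, Hgamma. Qed.

Definition square_distance (p z : C) : R := (Re z - Re p) ^ 2 + (Im z - Im p) ^ 2.

Lemma square_distance_gamma_continuous p t :
  continuity_pt (fun s => square_distance p (gamma s)) t.
Proof.
unfold square_distance.
apply (is_derive_continuity_pt _ t (2 * (Re (gamma t) - Re p) * Derive (fun s => Re (gamma s)) t +
   2 * (Im (gamma t) - Im p) * Derive (fun s => Im (gamma s)) t)).
assert (A := smooth1_is_derive _ smooth1_Re_gamma t).
assert (B := smooth1_is_derive _ smooth1_Im_gamma t).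
assert (M : forall u v : R -> R, forall a b l m, is_derive u t l -> is_derive v t m ->
  is_derive (fun s => (u s - a) ^ 2 + (v s - b) ^ 2) t (2 * (u t - a) * l + 2 * (v t - b) * m)).
{ intros u v a b l m U V; auto_derive.
  - split; [now exists l | split; [now exists m | easy]].
  - rewrite (is_derive_unique u t l U) (is_derive_unique v t m V); ring. }
exact (M _ _ _ _ _ _ A B).
Qed.

(** The rest of the curve stays away from [gamma t0]: the distance to it has a
    positive minimum over the complementary parameters, which form a compact
    interval. *)
Lemma parameter_nearby t0 delta : 0 < delta ->
  exists r, 0 < r /\ forall t, square_distance (gamma t0) (gamma t) < r ->
    exists t', Rabs (t' - t0) < delta /\ gamma t' = gamma t.
Proof.
(* Beyond half a period the two parameter intervals around [t0] would overlap. *)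
intros H; pose (e := Rmin delta (1 / 2)).
assert (He : 0 < e <= 1 / 2) by (unfold e; split; [apply Rmin_glb_lt; lra | apply Rmin_r]).
assert (Hed : e <= delta) by apply Rmin_l.
destruct (continuity_ab_min (fun s => square_distance (gamma t0) (gamma s)) (t0 + e) (t0 + 1 - e))
  as [m [Hm Hm']]; [lra | intros; apply square_distance_gamma_continuous |].
exists (square_distance (gamma t0) (gamma m)); split.
- assert (A := pow2_ge_0 (Re (gamma m) - Re (gamma t0))).
  assert (B := pow2_ge_0 (Im (gamma m) - Im (gamma t0))).
  unfold square_distance.
  apply Rnot_le_lt; intros L.
  apply (gamma_injective t0 m ltac:(lra)); apply C_ext; nra.
- intros t Ht; destruct (shift_into t0 t) as [k Hk].
  rewrite -(gamma_shift k t) in Ht |- *.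
  destruct (Rlt_le_dec (t + IZR k) (t0 + e)) as [L|L].
  { exists (t + IZR k); split; [rewrite Rabs_pos_eq; lra | easy]. }
  destruct (Rlt_le_dec (t0 + 1 - e) (t + IZR k)) as [M|M].
  { exists (t + IZR k + IZR (-1)); split; [|apply gamma_shift].
    apply Rabs_lt_between; simpl; lra. }
  generalize (Hm (t + IZR k) (conj L M)); lra.
Qed.

Definition bump (p : C) (r : R) (z : C) : C :=
  real_comp (fun s => cutoff (2 / r * s)) (fun w => RtoC (square_distance p w)) z.

Lemma smooth_square_distance p : smooth_to_closure everywhere (fun w => RtoC (square_distance p w)).
Proof.
pose (u b w := (RtoC (coord b w) + - RtoC (coord b p))%C).
apply (smooth_ext _ (fun w => u axis_x w * u axis_x w + u axis_y w * u axis_y w)%C).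
- intros w; unfold square_distance, u; apply C_ext; simpl; ring.
- assert (S : forall b, smooth_to_closure everywhere (u b)).
  { intros b; apply smooth_plus; [apply smooth_coordinate | apply smooth_const]. }
  apply smooth_plus; now apply smooth_mult.
Qed.

Lemma smooth_bump p r : smooth_to_closure everywhere (bump p r).
Proof.
apply smooth_real_comp; [|apply smooth_square_distance].
apply (smooth1_comp cutoff); [apply smooth1_cutoff|].
apply smooth1_mult; [apply smooth1_const | apply smooth1_id].
Qed.

Lemma bump_eq0 p r z : 0 < r -> r / 2 <= square_distance p z -> bump p r z = 0.
Proof.
intros Hr H; unfold bump, real_comp; simpl; rewrite cutoff_eq0 //.
apply Rmult_le_reg_l with (r / 2); [lra|].
replace (r / 2 * (2 / r * square_distance p z)) with (square_distance p z) by (field; lra); lra.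
Qed.

Lemma bump_eq1 p r z : 0 < r -> square_distance p z <= r / 4 -> bump p r z = 1.
Proof.
intros Hr H; unfold bump, real_comp; simpl; rewrite cutoff_eq1 //.
apply Rmult_le_reg_l with (r / 2); [lra|].
replace (r / 2 * (2 / r * square_distance p z)) with (square_distance p z) by (field; lra); lra.
Qed.

Definition vanishes_off_box (B : R) (f : C -> C) : Prop :=
  forall z, B < Rabs (Re z) \/ B < Rabs (Im z) -> f z = 0.

(** What is asked of a defining function, with the lower bound only on an arc.
    As [dbar rho] is required to be nonnegative on the whole curve, the
    condition is stable under addition, and defining functions of adjacent arcs
    can be added up. *)
Definition defining_on_arc (u v : R) : Prop :=
  exists rho m B, smooth_to_closure everywhere rho /\ 0 < m /\
    vanishes_off_box B rho /\ (forall t, rho (gamma t) = 0) /\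
    forall t, exists lambda, dbar rho (gamma t) = RtoC lambda /\ 0 <= lambda /\
      (u <= t <= v -> m <= lambda).

Lemma defining_on_arc_cat u v w : defining_on_arc u v -> defining_on_arc v w ->
  defining_on_arc u w.
Proof.
intros [r1 [m1 [B1 [S1 [P1 [V1 [Z1 L1]]]]]]] [r2 [m2 [B2 [S2 [P2 [V2 [Z2 L2]]]]]]].
exists (fun z => r1 z + r2 z)%C, (Rmin m1 m2), (Rmax B1 B2).
split; [now apply smooth_plus|]; split; [now apply Rmin_glb_lt|].
split; [|split].
- assert (M1 := Rmax_l B1 B2); assert (M2 := Rmax_r B1 B2).
  intros z Hz; rewrite V1 ?V2; [ring | |]; destruct Hz; lra.
- intros t; rewrite Z1 Z2; ring.
- intros t; destruct (L1 t) as [l1 [E1 [N1 K1]]]; destruct (L2 t) as [l2 [E2 [N2 K2]]].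
  exists (l1 + l2); rewrite dbar_plus; try now apply smooth_everywhere_differentiable_at.
  rewrite E1 E2 RtoC_plus; split; [easy|]; split; [lra|].
  assert (M1 := Rmin_l m1 m2); assert (M2 := Rmin_r m1 m2).
  intros Ht; destruct (Rle_dec t v); [generalize (K1 ltac:(lra)) | generalize (K2 ltac:(lra))]; lra.
Qed.

(** A local defining function [rho0] is multiplied by the conjugate of its own
    [dbar]: on the curve, [dbar] of the product is [Cmod (dbar rho0) ^ 2], hence
    nonnegative whatever the sign of [rho0].
    The bump function restricts it to the part of the curve on which [rho0]
    vanishes. *)
Lemma defining_near t0 rho0 delta :
  smooth_to_closure everywhere rho0 -> (forall z, 1 / 4 <= Cmod (dbar rho0 z) ^ 2) ->
  0 < delta -> (forall t, Rabs (t - t0) < delta -> rho0 (gamma t) = 0) ->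
  exists d, 0 < d /\ forall u v, t0 - d < u -> v < t0 + d -> defining_on_arc u v.
Proof.
intros S0 G0 Hd Z0.
destruct (parameter_nearby t0 delta Hd) as [r [Hr HK]].
pose (p := gamma t0).
assert (SC := smooth_dbar everywhere _ open_plane_everywhere S0).
apply smooth_conj in SC.
pose (b := bump p r); assert (Sb : smooth_to_closure everywhere b) by apply smooth_bump.
pose (rho := fun z => (b z * (Cconj (dbar rho0 z) * rho0 z))%C).
assert (ZK : forall t, square_distance p (gamma t) < r -> rho0 (gamma t) = 0).
{ intros t Ht; destruct (HK t Ht) as [t' [T1 T2]]; rewrite -T2; now apply Z0. }
assert (C0 := square_distance_gamma_continuous p t0).
destruct (C0 (r / 4) ltac:(lra)) as [d [Hd' HC]].
assert (near1 : forall t, Rabs (t - t0) < d -> b (gamma t) = 1).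
{ intros t Ht; apply bump_eq1; [easy|].
  destruct (Req_dec t0 t) as [<-|Ne].
  - unfold square_distance, p; simpl; lra.
  - assert (Q := HC t (conj (conj I Ne) Ht)); simpl in Q; unfold Rdist in Q.
    unfold square_distance at 2 in Q; unfold p at 2 in Q; unfold p at 2 in Q.
    apply Rabs_lt_between in Q; fold p in Q; rewrite !Rminus_diag in Q; lra. }
exists d; split; [easy|]; intros u v Hu Hv.
exists rho, (1 / 4), (Rmax (Rabs (Re p)) (Rabs (Im p)) + (r + 1)).
split; [apply smooth_mult; [easy | now apply smooth_mult]|].
split; [lra|]; split; [|split].
- intros z Hz; unfold rho, b; rewrite bump_eq0; [ring | easy |].
  assert (M1 := Rmax_l (Rabs (Re p)) (Rabs (Im p))); assert (M2 := Rmax_r (Rabs (Re p)) (Rabs (Im p))).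
  assert (A := pow2_ge_0 (Re z - Re p)); assert (A' := pow2_ge_0 (Im z - Im p)).
  unfold square_distance; destruct Hz as [Hz|Hz].
  + assert (T := Rabs_triang_inv (Re z) (Re p)).
    rewrite -(pow2_abs (Re z - Re p)); nra.
  + assert (T := Rabs_triang_inv (Im z) (Im p)).
    rewrite -(pow2_abs (Im z - Im p)); nra.
- intros t; unfold rho; destruct (Rlt_le_dec (square_distance p (gamma t)) r) as [L|L].
  + rewrite ZK //; ring.
  + unfold b; rewrite bump_eq0 //; [ring|lra].
- intros t; exists (Re (b (gamma t)) * Cmod (dbar rho0 (gamma t)) ^ 2).
  split; [|split].
  + destruct (Rlt_le_dec (square_distance p (gamma t)) r) as [L|L].
    * unfold rho; rewrite !dbar_mult; try now apply smooth_everywhere_differentiable_at.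
      2: { now apply smooth_everywhere_differentiable_at, smooth_mult. }
      rewrite ZK // RtoC_mult Cmod2_conj.
      replace (RtoC (Re (b (gamma t)))) with (b (gamma t)) by now apply C_ext.
      ring.
    * (* The bump function vanishes in a neighbourhood of this point. *)
      replace (b (gamma t)) with (RtoC 0).
      2: { symmetry; apply bump_eq0; lra. }
      replace (Re 0 * Cmod (dbar rho0 (gamma t)) ^ 2) with 0 by (simpl; ring).
      assert (Cs := cauchy_plus _ _ _ (jet_head _ _ _ _ _ (smooth_square_distance p O))
                   (cauchy_const everywhere (RtoC 0))).
      destruct (Cs (gamma t) (r / 2) ltac:(lra)) as [e [He HE]].
      rewrite (dbar_eq_near _ (fun _ => RtoC 0) (gamma t) e He); [apply dbar_const|].
      intros w Hw; unfold rho, b; rewrite bump_eq0; [ring | easy |].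
      assert (Q := HE w (gamma t) I I Hw (near_center _ _ He)).
      rewrite !Cplus_0_r -RtoC_minus Cmod_R in Q; apply Rabs_lt_between in Q; lra.
  + apply Rmult_le_pos; [apply cutoff_ge0 | apply pow2_ge_0].
  + intros Ht; rewrite near1; [|apply Rabs_lt_between; lra].
    simpl Re; rewrite Rmult_1_l; apply G0.
Qed.

(** Near each of its points the curve is a graph [y = g x] or [x = g y], with
    defining function [y - g x] or [x - g y]. One of the two partial
    derivatives of this real function is [1], so that its [dbar] is at least
    [1 / 2] in absolute value. *)
Lemma defining_locally t0 :
  exists d, 0 < d /\ forall u v, t0 - d < u -> v < t0 + d -> defining_on_arc u v.
Proof.
assert (sq : forall x : R, 1 / 4 <= (x ^ 2 + 1) / 4) by (intros x; generalize (pow2_ge_0 x); lra).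
assert (P : forall (a b : axis) g, smooth1 g ->
    match a with axis_x => b = axis_y | axis_y => b = axis_x end ->
    let rho0 := (fun z => RtoC (coord b z) + -1 * real_comp g (fun w => RtoC (coord a w)) z)%C in
    smooth_to_closure everywhere rho0 /\ forall z, 1 / 4 <= Cmod (dbar rho0 z) ^ 2).
{ intros a b g Sg Hab rho0; split.
  - apply smooth_plus; [apply smooth_coordinate|].
    apply smooth_scal, smooth_real_comp; [easy | apply smooth_coordinate].
  - intros z.
    pose (gz := real_comp g (fun w => RtoC (coord a w))).
    assert (D : forall e, is_partial e rho0 z
       (kronecker e b + (0 * gz z + -1 * RtoC (Re (kronecker e a) * Derive g (coord a z))))%C).
    { intros e; apply is_partial_plus; [apply is_partial_coordinate|].
      apply (is_partial_mult e (fun _ => RtoC (-1))); [apply is_partial_const|].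
      apply is_partial_real_comp; [apply (smooth1_is_derive g Sg)|apply is_partial_coordinate]. }
    rewrite (dbar_of_partials rho0 z _ _ (D axis_x) (D axis_y)); clear D.
    apply Rle_trans with (1 := sq (Derive g (coord a z))); right.
    rewrite Cmod2_alt; destruct a; rewrite Hab; unfold Re, Im; simpl; field. }
assert (T : Derive (fun s => Re (gamma s)) t0 <> 0 \/ Derive (fun s => Im (gamma s)) t0 <> 0).
{ destruct Hgamma as [_ [_ [_ [_ H]]]].
  destruct (Req_dec (Derive (fun s => Re (gamma s)) t0) 0) as [E|]; [right|now left].
  intros E'; apply (H t0); now rewrite E E'. }
destruct T as [T|T].
- destruct (locally_graph _ _ t0 smooth1_Re_gamma smooth1_Im_gamma T) as [g [delta [Sg [Hd Hg]]]].
  destruct (P axis_x axis_y g Sg eq_refl) as [S0 G0].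
  apply (defining_near t0 _ delta S0 G0 Hd).
  intros t Ht; unfold real_comp; simpl; rewrite (Hg t Ht).
  apply C_ext; simpl; ring.
- destruct (locally_graph _ _ t0 smooth1_Im_gamma smooth1_Re_gamma T) as [g [delta [Sg [Hd Hg]]]].
  destruct (P axis_y axis_x g Sg eq_refl) as [S0 G0].
  apply (defining_near t0 _ delta S0 G0 Hd).
  intros t Ht; unfold real_comp; simpl; rewrite (Hg t Ht).
  apply C_ext; simpl; ring.
Qed.

(** Compactness of the interval for a property of arcs that can be
    concatenated. *)
Lemma interval_induction (P : R -> R -> Prop) :
  (forall u v w, P u v -> P v w -> P u w) ->
  (forall x, exists d, 0 < d /\ forall u v, x - d < u -> v < x + d -> P u v) ->
  P 0 1.
Proof.
intros Cat Loc.
pose (E v := 0 <= v <= 1 /\ P 0 v).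
destruct (Loc 0) as [d0 [Hd0 P0]].
assert (E0 : E 0) by (split; [lra | apply P0; lra]).
destruct (completeness E) as [s [Us Ls]]; [exists 1; intros v [H _]; lra | now exists 0 |].
assert (s1 : s <= 1) by (apply Ls; intros v [H _]; lra).
assert (s0 : 0 <= s) by now apply Us.
destruct (Loc s) as [d [Hd Ps]].
assert (X : exists v, E v /\ s - d < v).
{ apply NNPP; intros N; assert (s <= s - d); [|lra].
  apply Ls; intros v Ev; apply Rnot_lt_le; intros L; apply N; now exists v. }
destruct X as [v [[_ Pv] Lv]].
assert (Ew : E (Rmin 1 (s + d / 2))).
{ split; [split; [apply Rmin_glb; lra | apply Rmin_l]|].
  apply (Cat _ v); [easy|]; apply Ps; [easy|].
  apply Rle_lt_trans with (1 := Rmin_r _ _); lra. }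
assert (L := Us _ Ew); destruct Ew as [_ Pw]; revert L Pw.
unfold Rmin; destruct (Rle_dec 1 (s + d / 2)); [easy | lra].
Qed.

(** The bound by [1] is a normalisation: it makes an order of vanishing along
    the curve imply all lower ones. *)
Lemma defining_function : exists rho m B,
  smooth_to_closure everywhere rho /\ 0 < m /\ vanishes_off_box B rho /\
  (forall z, Cmod (rho z) <= 1) /\ (forall t, rho (gamma t) = 0) /\
  forall t, exists lambda, dbar rho (gamma t) = RtoC lambda /\ m <= lambda.
Proof.
destruct (interval_induction defining_on_arc defining_on_arc_cat defining_locally)
  as [rho [m [B [S [Hm [V [Z L]]]]]]].
destruct (cauchy_bounded_on_boxes everywhere rho B (jet_head _ _ _ _ _ (S O))) as [c Hc].
pose (k := / (Rabs c + 1)).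
assert (Hk : 0 < k) by (apply Rinv_0_lt_compat; generalize (Rabs_pos c); lra).
exists (fun z => k * rho z)%C, (k * m), B.
split; [now apply smooth_scal|]; split; [now apply Rmult_lt_0_compat|].
split; [|split; [|split]].
- intros z Hz; rewrite V //; ring.
- intros z; rewrite Cmod_mult Cmod_R Rabs_pos_eq; [|lra].
  destruct (classic (B < Rabs (Re z) \/ B < Rabs (Im z))) as [H|H].
  + rewrite V // Cmod_0; lra.
  + assert (Q := Hc z I ltac:(lra) ltac:(lra)); assert (Q' := Rle_abs c).
    apply Rmult_le_reg_l with (Rabs c + 1); [generalize (Rabs_pos c); lra|].
    unfold k; rewrite -Rmult_assoc Rinv_r; generalize (Rabs_pos c); lra.
- intros t; rewrite Z; ring.
- intros t; destruct (shift_into 0 t) as [j Hj].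
  rewrite -(gamma_shift j t); destruct (L (t + IZR j)) as [l [E [_ K]]].
  exists (k * l); split; [|apply Rmult_le_compat_l; [lra|apply K; lra]].
  rewrite dbar_mult; try apply smooth_everywhere_differentiable_at; auto using smooth_const.
  rewrite dbar_const E RtoC_mult; ring.
Qed.
End Curve.

(** * Series of functions *)

Fixpoint partial_sum (T : nat -> C -> C) (K : nat) (z : C) : C :=
  match K with
  | O => 0
  | S K' => (partial_sum T K' z + T K' z)%C
  end.

Definition sum_series (T : nat -> C -> C) (z : C) : C :=
  (Series (fun k => Re (T k z)), Series (fun k => Im (T k z))).

Lemma ex_series_geometric (a : nat -> R) B :
  (forall k, Rabs (a k) <= B * (1 / 2) ^ k) -> ex_series a.
Proof.
intros H; apply: (ex_series_le a (fun k => B * (1 / 2) ^ k)); [exact H|].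
apply: (ex_series_scal_l B (fun k => (1 / 2) ^ k)); apply ex_series_geom.
rewrite Rabs_pos_eq; lra.
Qed.

Lemma Series_geometric_bound (a : nat -> R) B :
  (forall k, Rabs (a k) <= B * (1 / 2) ^ k) -> Rabs (Series a) <= 2 * B.
Proof.
intros H.
assert (E : ex_series (fun k => Rabs (a k))).
{ apply (ex_series_geometric _ B); intros k; now rewrite Rabs_Rabsolu. }
apply Rle_trans with (1 := Series_Rabs a E).
apply Rle_trans with (Series (fun k => B * (1 / 2) ^ k)).
- apply Series_le; [intros k; split; [apply Rabs_pos | apply H]|].
  apply (ex_series_geometric _ B); intros k.
  rewrite Rabs_pos_eq; [lra|]; apply Rle_trans with (2 := H k), Rabs_pos.
- rewrite Series_scal_l Series_geom; [lra|]; rewrite Rabs_pos_eq; lra.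
Qed.

Lemma sum_series_bound T z B :
  (forall k, Cmod (T k z) <= B * (1 / 2) ^ k) -> Cmod (sum_series T z) <= 4 * B.
Proof.
intros H; apply Rle_trans with (1 := Cmod_le_sum _).
assert (A : Rabs (Re (sum_series T z)) <= 2 * B).
{ apply Series_geometric_bound; intros k; apply Rle_trans with (2 := H k), Rabs_Re_le. }
assert (A' : Rabs (Im (sum_series T z)) <= 2 * B).
{ apply Series_geometric_bound; intros k; apply Rle_trans with (2 := H k), Rabs_Im_le. }
lra.
Qed.

Lemma sum_series_split T z B K : (forall k, Cmod (T k z) <= B * (1 / 2) ^ k) ->
  sum_series T z = (partial_sum T K z + sum_series (fun k => T (K + k)%nat) z)%C.
Proof.
revert T B; induction K as [|K IH]; intros T B H; [symmetry; apply Cplus_0_l|].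
rewrite (IH T B H) /= -Cplus_assoc; f_equal.
assert (H' : forall k, Cmod (T (K + k)%nat z) <= B * (1 / 2) ^ K * (1 / 2) ^ k).
{ intros k; rewrite Rmult_assoc -pow_add; apply H. }
unfold sum_series; rewrite (Series_incr_1 (fun k => Re _)).
2: { apply (ex_series_geometric _ (B * (1 / 2) ^ K)); intros k.
     apply Rle_trans with (2 := H' k), Rabs_Re_le. }
rewrite (Series_incr_1 (fun k => Im _)).
2: { apply (ex_series_geometric _ (B * (1 / 2) ^ K)); intros k.
     apply Rle_trans with (2 := H' k), Rabs_Im_le. }
rewrite !Nat.add_0_r; apply C_ext; simpl; f_equal; apply Series_ext; intros k;
  do 2 f_equal; lia.
Qed.

Lemma sum_series_remainder T z B K : (forall k, Cmod (T k z) <= B * (1 / 2) ^ k) ->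
  Cmod (sum_series T z - partial_sum T K z) <= 4 * B * (1 / 2) ^ K.
Proof.
intros H; rewrite (sum_series_split T z B K H).
match goal with |- Cmod ?x <= _ => replace x with (sum_series (fun k => T (K + k)%nat) z) by ring end.
rewrite Rmult_assoc; apply sum_series_bound; intros k.
rewrite Rmult_assoc -pow_add; apply H.
Qed.

Lemma geometric_small B eps : 0 < eps -> exists K, forall k, (K <= k)%nat -> B * (1 / 2) ^ k < eps.
Proof.
intros He; destruct (pow_lt_1_zero (1 / 2) ltac:(rewrite Rabs_pos_eq; lra) (eps / (Rabs B + 1)))
  as [K HK].
- apply Rdiv_lt_0_compat; [easy|]; generalize (Rabs_pos B); lra.
- exists K; intros k Hk; specialize (HK k Hk).
  assert (P : 0 < (1 / 2) ^ k) by (apply pow_lt; lra).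
  rewrite Rabs_pos_eq in HK; [|lra].
  assert (Bp := Rabs_pos B); assert (Bl := Rle_abs B).
  apply Rle_lt_trans with ((Rabs B + 1) * (1 / 2) ^ k); [nra|].
  apply Rlt_le_trans with ((Rabs B + 1) * (eps / (Rabs B + 1))).
  + apply Rmult_lt_compat_l; lra.
  + right; field; lra.
Qed.

Lemma is_partial_partial_sum a T T' z K : (forall k, is_partial a (T k) z (T' k z)) ->
  is_partial a (partial_sum T K) z (partial_sum T' K z).
Proof.
intros H; induction K as [|K IH]; [apply is_partial_const | now apply is_partial_plus].
Qed.

(** Termwise differentiation along a horizontal or vertical segment. *)
Lemma is_partial_sum_series (D : C -> Prop) a T T' B z : open_plane D -> D z ->
  (forall w k, D w -> is_partial a (T k) w (T' k w)) ->
  (forall w k, D w -> Cmod (T k w) <= B * (1 / 2) ^ k) ->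
  (forall w k, D w -> Cmod (T' k w) <= B * (1 / 2) ^ k) ->
  is_partial a (sum_series T) z (sum_series T' z).
Proof.
intros HD Dz HT B0 B1; destruct (HD z Dz) as [d [Hd Hw]].
assert (Ds : forall t, Boule (coord a z) (mkposreal d Hd) t -> D (slice a z t)).
{ intros t Ht; now apply Hw, near_slice. }
assert (HP : forall t K, D (slice a z t) ->
  is_derive (fun s => Re (partial_sum T K (slice a z s))) t (Re (partial_sum T' K (slice a z t))) /\
  is_derive (fun s => Im (partial_sum T K (slice a z s))) t (Im (partial_sum T' K (slice a z t)))).
{ intros t K Dt.
  destruct (is_partial_partial_sum a T T' (slice a z t) K (fun k => HT _ k Dt)) as [X Y].
  rewrite coord_slice in X, Y; split.
  - apply: is_derive_ext X; intros s; now rewrite slice_slice.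
  - apply: is_derive_ext Y; intros s; now rewrite slice_slice. }
assert (L : forall T0 w, D w -> (forall w k, D w -> Cmod (T0 k w) <= B * (1 / 2) ^ k) ->
   forall K, Cmod (sum_series T0 w - partial_sum T0 K w) <= 4 * B * (1 / 2) ^ K).
{ intros T0 w Dw H; intros K; apply sum_series_remainder; auto. }
assert (G : forall pr : C -> R, (forall w, Rabs (pr w) <= Cmod w) ->
  (forall w w', pr (w - w')%C = pr w - pr w') ->
  (forall K t, D (slice a z t) -> is_derive (fun s => pr (partial_sum T K (slice a z s))) t
      (pr (partial_sum T' K (slice a z t)))) ->
  is_derive (fun t => pr (sum_series T (slice a z t))) (coord a z) (pr (sum_series T' z))).
{ intros pr Hpr Hlin Hder; apply is_derive_Reals.
  assert (E := CVU_derivable (fun K t => pr (partial_sum T K (slice a z t)))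
     (fun K t => pr (partial_sum T' K (slice a z t)))
     (fun t => pr (sum_series T (slice a z t))) (fun t => pr (sum_series T' (slice a z t)))
     (coord a z) (mkposreal d Hd)).
  replace (sum_series T' z) with (sum_series T' (slice a z (coord a z))) by now rewrite slice_coord.
  apply E; clear E.
  - intros eps He; destruct (geometric_small (4 * B) eps He) as [K HK].
    exists K; intros k t Hk Ht; rewrite -Hlin.
    apply Rle_lt_trans with (2 := HK k Hk), Rle_trans with (2 := L T' _ (Ds t Ht) B1 k), Hpr.
  - intros t Ht eps He; destruct (geometric_small (4 * B) eps He) as [K HK].
    exists K; intros k Hk; unfold Rdist; rewrite Rabs_minus_sym -Hlin.
    apply Rle_lt_trans with (2 := HK k Hk), Rle_trans with (2 := L T _ (Ds t Ht) B0 k), Hpr.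
  - intros K t Ht; apply is_derive_Reals, Hder, Ds, Ht.
  - unfold Boule; simpl; rewrite Rminus_diag Rabs_R0; easy. }
split; apply G; try easy.
- apply Rabs_Re_le.
- intros K t Dt; now apply HP.
- apply Rabs_Im_le.
- intros K t Dt; now apply HP.
Qed.

Lemma cauchy_partial_sum D T K : (forall k, cauchy_at_closure D (T k)) ->
  cauchy_at_closure D (partial_sum T K).
Proof.
intros H; induction K as [|K IH]; [apply cauchy_const | now apply cauchy_plus].
Qed.

(** * Vanishing along the zero set of a function *)

Section Weight.
Variable rho : C -> C.
Hypothesis rho_le1 : forall z, Cmod (rho z) <= 1.

(** Vanishing to order [n] along the zero set of [rho], with the constant made
    explicit as needed to sum a series. *)
Definition weight_const (D : C -> Prop) (c : R) (n : nat) (f : C -> C) : Prop :=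
  cauchy_at_closure D f /\ forall z, D z -> Cmod (f z) <= c * Cmod (rho z) ^ n.

Definition weight (D : C -> Prop) (n : nat) (f : C -> C) : Prop :=
  exists c, 0 <= c /\ weight_const D c n f.

Lemma rho_pow_le n m z : (m <= n)%nat -> Cmod (rho z) ^ n <= Cmod (rho z) ^ m.
Proof.
intros H; replace n with (m + (n - m))%nat by lia; rewrite pow_add.
assert (P := pow_le _ m (Cmod_ge_0 (rho z))).
assert (Q : Cmod (rho z) ^ (n - m) <= 1).
{ rewrite -(pow1 (n - m)); apply pow_incr; split; [apply Cmod_ge_0 | apply rho_le1]. }
nra.
Qed.

Lemma rho_pow_ge0 n z : 0 <= Cmod (rho z) ^ n.
Proof. apply pow_le, Cmod_ge_0. Qed.

Lemma weight_const_lower D c c' n m f : 0 <= c <= c' -> (m <= n)%nat ->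
  weight_const D c n f -> weight_const D c' m f.
Proof.
intros Hc Hm [F B]; split; [easy|]; intros z Dz.
apply Rle_trans with (1 := B z Dz).
apply Rmult_le_compat; [lra | apply rho_pow_ge0 | lra | now apply rho_pow_le].
Qed.

Lemma weight_lower D n m f : (m <= n)%nat -> weight D n f -> weight D m f.
Proof.
intros H [c [Hc F]]; exists c; split; [easy|]; apply (weight_const_lower D c c n m); auto; lra.
Qed.

Lemma weight_const_plus D c c' n f g : weight_const D c n f -> weight_const D c' n g ->
  weight_const D (c + c') n (fun z => f z + g z)%C.
Proof.
intros [F B] [G B']; split; [now apply cauchy_plus|]; intros z Dz.
apply Rle_trans with (1 := Cmod_triangle _ _); generalize (B z Dz) (B' z Dz); lra.
Qed.

Lemma weight_plus D n f g : weight D n f -> weight D n g ->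
  weight D n (fun z => f z + g z)%C.
Proof.
intros [c [Hc F]] [c' [Hc' G]]; exists (c + c'); split; [lra | now apply weight_const_plus].
Qed.

Lemma weight_mult D n m f g : weight D n f -> weight D m g ->
  weight D (n + m) (fun z => f z * g z)%C.
Proof.
intros [c [Hc [F B]]] [c' [Hc' [G B']]]; exists (c * c'); split; [now apply Rmult_le_pos|].
split; [now apply cauchy_mult|]; intros z Dz; rewrite Cmod_mult pow_add.
replace (c * c' * (Cmod (rho z) ^ n * Cmod (rho z) ^ m))
  with ((c * Cmod (rho z) ^ n) * (c' * Cmod (rho z) ^ m)) by ring.
apply Rmult_le_compat; auto using Cmod_ge_0.
Qed.

Lemma weight_const_eq D c n f g : (forall z, D z -> f z = g z) ->
  weight_const D c n f -> weight_const D c n g.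
Proof.
intros E [F B]; split; [now apply (cauchy_eq D f)|]; intros z Dz; rewrite -(E z Dz); auto.
Qed.

Lemma weight_eq D n f g : (forall z, D z -> f z = g z) -> weight D n f -> weight D n g.
Proof.
intros E [c [Hc F]]; exists c; split; [easy | now apply (weight_const_eq D c n f)].
Qed.

Lemma jet_weight_plus D N n f g : jet D (weight D) N n f -> jet D (weight D) N n g ->
  jet D (weight D) N n (fun z => f z + g z)%C.
Proof. apply jet_plus, weight_plus. Qed.

Lemma jet_weight_mult D N n m f g : jet D (weight D) N n f -> jet D (weight D) N m g ->
  jet D (weight D) N (n + m) (fun z => f z * g z)%C.
Proof.
apply jet_mult; try apply weight_lower; [apply weight_plus | apply weight_mult].
Qed.

Lemma jet_weight_lower D N n N' m f : (N' <= N)%nat -> (m <= n)%nat ->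
  jet D (weight D) N n f -> jet D (weight D) N' m f.
Proof. intros HN Hm; apply jet_lower; auto; apply weight_lower. Qed.

Lemma jet_weight_sub (D D' : C -> Prop) N n f : (forall z, D' z -> D z) ->
  jet D (weight D) N n f -> jet D' (weight D') N n f.
Proof.
intros H; apply jet_impl; [easy|]; intros k g [c [Hc [G B]]].
exists c; split; [easy|]; split; [now apply (cauchy_sub D) | auto].
Qed.

Lemma jet_weight_cauchy D N n f : jet D (weight D) N n f ->
  jet D (fun _ => cauchy_at_closure D) N 0 f.
Proof.
intros H; apply (jet_lower D (fun _ => cauchy_at_closure D) N N) with (n := n); auto; [lia|].
revert H; apply jet_impl; [easy|]; now intros k g [c [_ [G _]]].
Qed.

Lemma weight_bounded_support (D : C -> Prop) B f : cauchy_at_closure D f ->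
  vanishes_off_box B f -> weight D 0 f.
Proof.
intros F V; destruct (cauchy_bounded_on_boxes D f B F) as [c Hc].
exists (Rabs c); split; [apply Rabs_pos|]; split; [easy|].
intros z Dz; rewrite Rmult_1_r.
destruct (classic (B < Rabs (Re z) \/ B < Rabs (Im z))) as [H|H].
- rewrite V // Cmod_0; apply Rabs_pos.
- apply Rle_trans with (2 := Rle_abs c), Hc; auto; lra.
Qed.

Lemma vanishes_off_box_partial B f a : vanishes_off_box B f -> vanishes_off_box B (partial a f).
Proof.
intros V z Hz; apply is_partial_unique.
assert (X : exists d, 0 < d /\ forall w, near z d w -> B < Rabs (Re w) \/ B < Rabs (Im w)).
{ destruct Hz as [Hz|Hz].
  - exists (Rabs (Re z) - B); split; [lra|]; intros w [H _]; left.
    assert (T := Rabs_triang_inv (Re z) (Re w)); rewrite Rabs_minus_sym in H; lra.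
  - exists (Rabs (Im z) - B); split; [lra|]; intros w [_ H]; right.
    assert (T := Rabs_triang_inv (Im z) (Im w)); rewrite Rabs_minus_sym in H; lra. }
destruct X as [d [Hd HX]]; apply (is_partial_eq_near a (fun _ => RtoC 0) f z 0 d Hd).
- intros w Hw; symmetry; apply V, HX, Hw.
- apply is_partial_const.
Qed.

Lemma jet_weight_bounded_support D B N : open_plane D -> forall f, smooth_to_closure D f ->
  vanishes_off_box B f -> jet D (weight D) N 0 f.
Proof.
intros HD; induction N as [|N IH]; intros f F V; split; auto.
1, 2: apply (weight_bounded_support D B); [exact (jet_head _ _ _ _ _ (F O)) | easy].
intros a; exists (partial a f); split.
- intros z Dz; now apply (smooth_differentiable D).
- apply IH; [now apply smooth_partial | now apply vanishes_off_box_partial].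
Qed.

Lemma weight_const_geometric D B n T k z : 0 <= B ->
  weight_const D (B * (1 / 2) ^ k) n (T k) -> D z -> Cmod (T k z) <= B * (1 / 2) ^ k.
Proof.
intros HB [_ H] Dz; apply Rle_trans with (1 := H z Dz).
rewrite -{2}(Rmult_1_r (B * (1 / 2) ^ k)); apply Rmult_le_compat_l.
- apply Rmult_le_pos; [easy | apply pow_le; lra].
- apply (rho_pow_le n 0); lia.
Qed.

Lemma weight_sum_series D n B T : 0 <= B ->
  (forall k, weight_const D (B * (1 / 2) ^ k) n (T k)) -> weight D n (sum_series T).
Proof.
intros HB HT; exists (4 * B); split; [lra|]; split.
- apply cauchy_uniform_limit; intros eps He.
  destruct (geometric_small (4 * B) eps He) as [K HK].
  exists (partial_sum T K); split; [apply cauchy_partial_sum; intros k; apply HT|].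
  intros z Dz; apply Rle_trans with (4 * B * (1 / 2) ^ K); [|now apply Rlt_le, HK].
  apply sum_series_remainder; intros k; now apply (weight_const_geometric D B n).
- intros z Dz; rewrite Rmult_assoc; apply sum_series_bound; intros k.
  apply Rle_trans with (1 := proj2 (HT k) z Dz); right; ring.
Qed.

(** A series dominated by a geometric one, together with its derivatives, may
    be differentiated term by term. *)
Lemma jet_sum_series D : open_plane D -> forall N n B T, 0 <= B ->
  (forall k, jet D (weight_const D (B * (1 / 2) ^ k)) N n (T k)) ->
  jet D (weight D) N n (sum_series T).
Proof.
intros HD; induction N as [|N IH]; intros n B T HB HT; split; auto.
1, 2: apply (weight_sum_series D n B); auto; intros k; exact (jet_head _ _ _ _ _ (HT k)).
intros a; exists (sum_series (fun k => partial a (T k))).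
assert (HP : forall k, jet D (weight_const D (B * (1 / 2) ^ k)) N (pred n) (partial a (T k))).
{ intros k; apply jet_partial; [easy | intros; now apply (weight_const_eq D _ _ f) | apply HT]. }
split; [|now apply (IH _ B)].
intros z Dz; apply (is_partial_sum_series D a T _ B); auto.
- intros w k Dw; apply (jet_is_partial D _ N n _ a w (HT k) Dw).
- intros w k Dw; now apply (weight_const_geometric D B n), Dw; [|apply (jet_head _ _ _ _ _ (HT k))].
- intros w k Dw.
  apply (weight_const_geometric D B (pred n) (fun k => partial a (T k)) k w HB); [|easy].
  apply (jet_head _ _ _ _ _ (HP k)).
Qed.

(** * Cutting off near the zero set *)

Hypothesis rho_smooth : smooth_to_closure everywhere rho.
Variable B0 : R.
Hypothesis rho_support : vanishes_off_box B0 rho.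

Lemma jet_weight_rho N : jet everywhere (weight everywhere) N 1 rho.
Proof.
assert (H := jet_weight_bounded_support everywhere B0 N open_plane_everywhere rho rho_smooth rho_support).
assert (W : weight everywhere 1 rho).
{ exists 1; split; [lra|]; split; [exact (jet_head _ _ _ _ _ (rho_smooth O))|].
  intros z _; simpl; lra. }
destruct N as [|N]; destruct H as [_ H]; now split.
Qed.

Definition square (z : C) : C := (rho z * Cconj (rho z))%C.

Lemma square_Cmod z : square z = RtoC (Cmod (rho z) ^ 2).
Proof. unfold square; now rewrite Cmod2_conj. Qed.

Lemma smooth_square : smooth_to_closure everywhere square.
Proof. apply smooth_mult; [easy | now apply smooth_conj]. Qed.

Lemma jet_weight_square_partial N a : jet everywhere (weight everywhere) N 1 (partial a square).
Proof.
apply (jet_partial everywhere (weight everywhere) N 2 square a open_plane_everywhere).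
{ intros n f g; apply weight_eq. }
apply (jet_weight_mult everywhere (S N) 1 1); [apply jet_weight_rho|].
assert (C0 : vanishes_off_box B0 (fun z => Cconj (rho z))).
{ intros z Hz; rewrite rho_support //; apply C_ext; simpl; ring. }
assert (H := jet_weight_bounded_support everywhere B0 (S N) open_plane_everywhere _
   (smooth_conj _ _ rho_smooth) C0).
assert (W : weight everywhere 1 (fun z => Cconj (rho z))).
{ exists 1; split; [lra|]; split; [exact (jet_head _ _ _ _ _ (smooth_conj _ _ rho_smooth O))|].
  intros z _; rewrite Cmod_conj; simpl; lra. }
destruct H as [_ H]; now split.
Qed.

(** Because [square] takes real values. *)
Lemma square_partial_real a z : RtoC (Re (partial a square z)) = partial a square z.
Proof.
apply C_ext; [easy|]; symmetry.
change (Derive (fun t => Im (square (slice a z t))) (coord a z) = 0).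
rewrite (Derive_ext _ (fun _ => 0)); [apply Derive_const|].
intros t; now rewrite square_Cmod.
Qed.

(** Cutting [v] off at distance [eps] from the zero set of [rho] is the case
    [j = 0]; powers of [/ eps ^ 2] come out when the cutoff is differentiated. *)
Definition localised (theta : R -> R) (v : C -> C) (j : nat) (eps : R) (z : C) : C :=
  (RtoC ((/ eps ^ 2) ^ j) * (v z * real_comp (fun s => theta (/ eps ^ 2 * s)%R) square z))%C.

Lemma smooth_localising theta eps : smooth1 theta ->
  smooth_to_closure everywhere (real_comp (fun s => theta (/ eps ^ 2 * s)) square).
Proof.
intros H; apply smooth_real_comp; [|apply smooth_square].
apply (smooth1_comp theta); [easy|].
apply smooth1_mult; [apply smooth1_const | apply smooth1_id].
Qed.

(** Localised functions are stable under differentiation. In the second term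
    the factor [/ eps ^ 2] is compensated by the derivative of [square], which
    vanishes with [rho]: the order of vanishing minus [2 * j] drops by one. *)
Lemma is_partial_localised theta v j eps a z l : smooth1 theta -> is_partial a v z l ->
  is_partial a (localised theta v j eps) z
   (localised theta (fun _ => l) j eps z +
    localised (Derive theta) (fun w => v w * partial a square w)%C (S j) eps z)%C.
Proof.
intros Ht Hv.
assert (Hs : is_derive (fun s => theta (/ eps ^ 2 * s)) (Re (square z))
                 (/ eps ^ 2 * Derive theta (/ eps ^ 2 * Re (square z)))).
{ apply: (is_derive_comp theta (fun s => / eps ^ 2 * s)); [now apply smooth1_is_derive|].
  rewrite -{2}(Rmult_1_r (/ eps ^ 2)); apply is_derive_scal; apply: is_derive_id. }
assert (Hq := smooth_differentiable everywhere square a z smooth_square I).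
assert (E := is_partial_mult a (fun _ => RtoC ((/ eps ^ 2) ^ j)) _ z _ _ (is_partial_const a _ z)
   (is_partial_mult a v _ z _ _ Hv (is_partial_real_comp a _ square z _ _ Hs Hq))).
match type of E with is_partial _ _ _ ?x => match goal with |- is_partial _ _ _ ?y =>
  replace y with x; [exact E|] end end.
rewrite /localised /real_comp; set (k := / eps ^ 2).
rewrite -(tech_pow_Rmult k j) !RtoC_mult square_partial_real; cbv beta; ring.
Qed.

(** On the support of the cutoff [Cmod (rho z) <= eps], so that of the factors
    [rho] in [v] two pay for each power of [/ eps ^ 2] and one pays for the
    factor [eps] in the bound. *)
Lemma weight_localised D n j v theta :
  smooth1 theta -> (forall s, 1 <= s -> theta s = 0) -> weight D (n + 1 + 2 * j) v ->
  exists M, 0 <= M /\ forall eps, 0 < eps <= 1 ->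
    weight_const D (M * eps) n (localised theta v j eps).
Proof.
intros Ht H0 [c [Hc [Cv Bv]]].
destruct (continuity_ab_maj (fun s => Rabs (theta s)) 0 1) as [x [Hx _]]; [lra| |].
{ intros s _; apply (continuity_pt_comp theta Rabs); [|apply Rcontinuity_abs].
  apply (is_derive_continuity_pt _ _ (Derive theta s)); now apply smooth1_is_derive. }
assert (M0 : 0 <= c * Rabs (theta x)) by (apply Rmult_le_pos; [easy | apply Rabs_pos]).
exists (c * Rabs (theta x)); split; [easy|]; intros eps He; split.
{ apply cauchy_mult; [apply cauchy_const|]; apply cauchy_mult; [easy|].
  apply (cauchy_sub everywhere); [easy|].
  exact (jet_head _ _ _ _ _ (smooth_localising theta eps Ht O)). }
intros z Dz; specialize (Bv z Dz); revert Bv; unfold localised, real_comp.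
rewrite square_Cmod; simpl Re; rewrite !Cmod_mult !Cmod_R.
assert (P : 0 < / eps ^ 2) by (apply Rinv_0_lt_compat, pow_lt; lra).
assert (Pj := pow_lt _ j P); rewrite (Rabs_pos_eq _ (Rlt_le _ _ Pj)).
generalize (Cmod_ge_0 (rho z)); set (r := Cmod (rho z)); intros Hr.
replace (r ^ (n + 1 + 2 * j)) with (r ^ n * r * r ^ (2 * j)) by (rewrite !pow_add; simpl; ring).
intros Bv; assert (Rn := pow_le _ n Hr).
destruct (Rle_lt_dec 1 (/ eps ^ 2 * r ^ 2)) as [L|L].
{ rewrite H0 // Rabs_R0 !Rmult_0_r.
  apply Rmult_le_pos; [apply Rmult_le_pos; lra | easy]. }
assert (Hx' : Rabs (theta (/ eps ^ 2 * r ^ 2)) <= Rabs (theta x)).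
{ apply Hx; split; [apply Rmult_le_pos; [lra | apply pow2_ge_0] | lra]. }
assert (Lr : r <= eps).
{ apply Rnot_lt_le; intros K; apply (Rlt_not_le _ _ L).
  apply Rmult_le_reg_l with (eps ^ 2); [apply pow_lt; lra|].
  rewrite -Rmult_assoc Rinv_r; [nra | apply Rgt_not_eq, pow_lt; lra]. }
assert (Y : (/ eps ^ 2) ^ j * r ^ (2 * j) <= 1).
{ rewrite pow_mult -Rpow_mult_distr -(pow1 j); apply pow_incr; split; [|lra].
  apply Rmult_le_pos; [lra | apply pow2_ge_0]. }
apply Rle_trans with ((/ eps ^ 2) ^ j * (c * (r ^ n * r * r ^ (2 * j)) * Rabs (theta x))).
{ apply Rmult_le_compat_l; [lra|]; apply Rmult_le_compat; auto using Cmod_ge_0, Rabs_pos. }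
replace ((/ eps ^ 2) ^ j * (c * (r ^ n * r * r ^ (2 * j)) * Rabs (theta x)))
  with (((/ eps ^ 2) ^ j * r ^ (2 * j)) * (c * Rabs (theta x) * r * r ^ n)) by ring.
apply Rle_trans with (1 * (c * Rabs (theta x) * r * r ^ n)).
- apply Rmult_le_compat_r; [|easy].
  apply Rmult_le_pos; [now apply Rmult_le_pos | easy].
- rewrite Rmult_1_l; apply Rmult_le_compat_r; [easy|]; now apply Rmult_le_compat_l.
Qed.

Lemma Derive_eq0_right theta : smooth1 theta ->
  (forall s, 1 <= s -> theta s = 0) -> forall s, 1 <= s -> Derive theta s = 0.
Proof.
intros Ht H0 s Hs; apply cond_eq; intros eps He.
assert (Hd := smooth1_is_derive theta Ht s); apply is_derive_Reals in Hd.
destruct (Hd eps He) as [d Hd']; assert (Pd := cond_pos d).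
specialize (Hd' (d / 2) ltac:(lra) ltac:(rewrite Rabs_pos_eq; lra)).
rewrite !H0 in Hd'; try lra.
replace ((0 - 0) / (d / 2) - Derive theta s) with (- (Derive theta s - 0)) in Hd' by (field; lra).
now rewrite Rabs_Ropp in Hd'.
Qed.

(** A function that vanishes to order [n + 1] and is cut off at distance [eps]
    is small with [eps], together with its derivatives up to order [n]. This is
    what lets a series of such functions converge. *)
Lemma jet_localised D : forall N n j v theta,
  (N <= n)%nat -> smooth1 theta -> (forall s, 1 <= s -> theta s = 0) ->
  jet D (weight D) N (n + 1 + 2 * j) v ->
  exists M, 0 <= M /\ forall eps, 0 < eps <= 1 ->
    jet D (weight_const D (M * eps)) N n (localised theta v j eps).
Proof.
induction N as [|N IH]; intros n j v theta HN Ht H0 Hv;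
  destruct (weight_localised D n j v theta Ht H0 (jet_head _ _ _ _ _ Hv)) as [M [HM W]].
{ exists M; split; [easy|]; intros eps He; split; auto. }
destruct n as [|n]; [lia|]; destruct Hv as [Hv0 Hv].
assert (A : forall a, exists M', 0 <= M' /\ forall eps, 0 < eps <= 1 -> exists g,
   (forall z, D z -> is_partial a (localised theta v j eps) z (g z)) /\
   jet D (weight_const D (M' * eps)) N n g).
{ intros a; destruct (Hv a) as [va [V1 V2]].
  destruct (IH n j va theta ltac:(lia) Ht H0) as [M1 [P1 Q1]].
  { now replace (n + 1 + 2 * j)%nat with (pred (S n + 1 + 2 * j)) by lia. }
  destruct (IH n (S j) (fun w => v w * partial a square w)%C (Derive theta) ltac:(lia)
     (smooth1_Derive _ Ht) (Derive_eq0_right _ Ht H0)) as [M2 [P2 Q2]].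
  { replace (n + 1 + 2 * S j)%nat with (S n + 1 + 2 * j + 1)%nat by lia.
    apply jet_weight_mult.
    - apply (jet_weight_lower D (S N) (S n + 1 + 2 * j)); [lia | lia | now split].
    - apply (jet_weight_sub everywhere); [easy | apply jet_weight_square_partial]. }
  exists (M1 + M2); split; [lra|]; intros eps He.
  exists (fun z => localised theta va j eps z +
    localised (Derive theta) (fun w => v w * partial a square w)%C (S j) eps z)%C; split.
  - intros z Dz; now apply (is_partial_localised theta v j eps a z (va z) Ht), V1.
  - rewrite Rmult_plus_distr_r.
    apply (jet_plus D (weight_const D (M1 * eps)) (weight_const D (M2 * eps))); auto.
    intros k f g; apply weight_const_plus. }
destruct (A axis_x) as [Mx [Px Qx]]; destruct (A axis_y) as [My [Py Qy]].
exists (M + Mx + My); split; [lra|]; intros eps He; split.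
- apply (weight_const_lower D (M * eps) _ (S n)); auto; nra.
- assert (J : forall M' g, 0 <= M' <= M + Mx + My ->
     jet D (weight_const D (M' * eps)) N n g ->
     jet D (weight_const D ((M + Mx + My) * eps)) N n g).
  { intros M' g HM'; apply jet_impl; [easy|]; intros k f; apply weight_const_lower; [nra | lia]. }
  intros [|]; [destruct (Qx eps He) as [g [G1 G2]] | destruct (Qy eps He) as [g [G1 G2]]];
    exists g; split; auto; [apply (J Mx) | apply (J My)]; auto; lra.
Qed.

End Weight.

(** * The formal solution and its summation *)

Lemma open_plane_Re_gt h a : cauchy_at_closure everywhere h ->
  open_plane (fun z => a < Re (h z)).
Proof.
intros H z Hz; destruct (H z (Re (h z) - a) ltac:(lra)) as [d [Hd HB]].
exists d; split; [easy|]; intros w Hw.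
assert (X := HB w z I I Hw (near_center _ _ Hd)).
assert (Y := Rle_lt_trans _ _ _ (Rabs_Re_le _) X).
apply Rabs_lt_between in Y; unfold Cminus, Cplus, Copp, Re in *; simpl in Y; lra.
Qed.

Lemma jet_weight_constant rho D N c : jet D (weight rho D) N 0 (fun _ => c).
Proof.
revert c; induction N as [|N IH]; intros c; split; auto.
1, 2: exists (Cmod c); split; [apply Cmod_ge_0|]; split; [apply cauchy_const | intros; simpl; lra].
intros a; exists (fun _ => RtoC 0); split; auto; intros; apply is_partial_const.
Qed.

Section Solution.
Variable rho : C -> C.
Hypothesis rho_le1 : forall z, Cmod (rho z) <= 1.
Hypothesis rho_smooth : smooth_to_closure everywhere rho.
Variable B0 : R.
Hypothesis rho_support : vanishes_off_box B0 rho.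
Variable m : R.
Hypothesis m_pos : 0 < m.

(** A function, smooth on the whole line, that is [/ s] for
    [s >= m ^ 2 / 2]. *)
Definition regular_inverse (s : R) : R :=
  s * / (s * s + cutoff (/ (m ^ 2 / 2) ^ 2 * (s * s))).

Lemma m2_pos : 0 < m ^ 2 / 2.
Proof. generalize (pow_lt m 2 m_pos); lra. Qed.

Lemma regular_inverse_denominator s : 0 < s * s + cutoff (/ (m ^ 2 / 2) ^ 2 * (s * s)).
Proof.
destruct (Req_dec s 0) as [->|H].
- rewrite !Rmult_0_r cutoff_eq1; lra.
- generalize (cutoff_ge0 (/ (m ^ 2 / 2) ^ 2 * (s * s))); assert (0 < s * s) by nra; lra.
Qed.

Lemma smooth1_regular_inverse : smooth1 regular_inverse.
Proof.
assert (S2 : smooth1 (fun s => s * s)) by (apply smooth1_mult; apply smooth1_id).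
apply smooth1_mult; [apply smooth1_id|].
apply smooth1_inv; [intros s; generalize (regular_inverse_denominator s); lra|].
apply smooth1_plus; [easy|]; apply (smooth1_comp cutoff); [apply smooth1_cutoff|].
apply smooth1_mult; [apply smooth1_const | easy].
Qed.

Lemma regular_inverse_eq s : m ^ 2 / 2 <= s -> s * regular_inverse s = 1.
Proof.
intros H; assert (P := m2_pos); unfold regular_inverse; rewrite cutoff_eq0; [field; lra|].
assert (Q : 0 < (m ^ 2 / 2) ^ 2) by now apply pow_lt.
apply Rmult_le_reg_l with (1 := Q); rewrite -Rmult_assoc Rinv_r; nra.
Qed.

(** A globally smooth function of bounded support that is the inverse of
    [dbar rho] near the curve. *)
Definition sigma (z : C) : C :=
  (Cconj (dbar rho z) * real_comp regular_inverse (fun w => dbar rho w * Cconj (dbar rho w)) z)%C.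

Lemma smooth_dbar_rho : smooth_to_closure everywhere (dbar rho).
Proof. apply smooth_dbar; [apply open_plane_everywhere | easy]. Qed.

Lemma smooth_sigma : smooth_to_closure everywhere sigma.
Proof.
assert (S := smooth_dbar_rho); assert (S' := smooth_conj _ _ S).
apply smooth_mult; [easy|]; apply smooth_real_comp; [apply smooth1_regular_inverse|].
now apply smooth_mult.
Qed.

Lemma sigma_eq z : m ^ 2 / 2 <= Cmod (dbar rho z) ^ 2 -> (dbar rho z * sigma z)%C = 1.
Proof.
intros H; unfold sigma, real_comp; rewrite -Cmod2_conj Cmult_assoc -Cmod2_conj; simpl Re.
now rewrite -RtoC_mult regular_inverse_eq.
Qed.

Lemma sigma_support : vanishes_off_box B0 sigma.
Proof.
intros z Hz; unfold sigma, dbar; rewrite !(vanishes_off_box_partial B0 rho _ rho_support z Hz).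
apply C_ext; simpl; ring.
Qed.

Variables (D : C -> Prop) (U : C -> C).
Hypothesis D_open : open_plane D.
Hypothesis U_smooth : smooth_to_closure D U.

(** The coefficients of the formal solution, the sum of the terms
    [rho ^ (k + 1) * coefficient k]. The first one makes [dbar] of the sum
    equal to [U] to order zero; [coefficient (S k)] cancels the error left by
    the previous ones, [rho ^ (k + 1) * dbar (coefficient k)]. *)
Fixpoint coefficient (k : nat) : C -> C :=
  match k with
  | O => fun z => (sigma z * U z)%C
  | S k' => fun z => (- / (INR k' + 2) * (sigma z * dbar (coefficient k') z))%C
  end.

Lemma smooth_coefficient k : smooth_to_closure D (coefficient k).
Proof.
assert (S := smooth_sub everywhere D sigma (fun _ _ => I) smooth_sigma).
induction k as [|k IH]; simpl; [now apply smooth_mult|].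
apply smooth_scal, smooth_mult; [easy | now apply smooth_dbar].
Qed.

Lemma coefficient_support k : vanishes_off_box B0 (coefficient k).
Proof. intros z Hz; destruct k; simpl; rewrite sigma_support //; ring. Qed.

Definition formal_term (k : nat) (z : C) : C := (Cpow (rho z) (S k) * coefficient k z)%C.

Lemma rho_differentiable z : differentiable_at rho z.
Proof. now apply smooth_everywhere_differentiable_at. Qed.

Lemma rho_pow_differentiable n z : differentiable_at (fun w => Cpow (rho w) n) z.
Proof. now apply smooth_everywhere_differentiable_at, smooth_pow. Qed.

Lemma dbar_rho_pow n z :
  dbar (fun w => Cpow (rho w) (S n)) z = (RtoC (INR (S n)) * Cpow (rho z) n * dbar rho z)%C.
Proof.
induction n as [|n IH].
- change (fun w => Cpow (rho w) 1) with (fun w => (rho w * 1)%C).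
  rewrite dbar_mult; [|apply rho_differentiable | apply (rho_pow_differentiable 0)].
  rewrite dbar_const; simpl; ring.
- change (fun w => Cpow (rho w) (S (S n))) with (fun w => (rho w * Cpow (rho w) (S n))%C).
  rewrite dbar_mult; [|apply rho_differentiable | apply rho_pow_differentiable].
  rewrite IH (S_INR (S n)) RtoC_plus; change (Cpow (rho z) (S n)) with (rho z * Cpow (rho z) n)%C; ring.
Qed.

Lemma smooth_formal_term k : smooth_to_closure D (formal_term k).
Proof.
apply smooth_mult; [|apply smooth_coefficient].
apply (smooth_sub everywhere); [easy|]; now apply smooth_pow.
Qed.

Lemma smooth_partial_sum (T : nat -> C -> C) K :
  (forall k, smooth_to_closure D (T k)) -> smooth_to_closure D (partial_sum T K).
Proof.
intros H; induction K as [|K IH]; [apply (smooth_const D 0) | now apply (smooth_plus D (partial_sum T K) (T K))].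
Qed.

Lemma dbar_formal_term k z : D z ->
  dbar (formal_term k) z = (RtoC (INR (S k)) * Cpow (rho z) k * dbar rho z * coefficient k z +
                            Cpow (rho z) (S k) * dbar (coefficient k) z)%C.
Proof.
intros Dz; unfold formal_term; rewrite dbar_mult.
- now rewrite dbar_rho_pow.
- apply rho_pow_differentiable.
- apply (smooth_differentiable_at D); [apply smooth_coefficient | easy].
Qed.

(** The sum telescopes: the error of each term is cancelled by the next one. *)
Lemma dbar_formal_sum M z : D z -> m ^ 2 / 2 <= Cmod (dbar rho z) ^ 2 ->
  dbar (partial_sum formal_term (S M)) z =
  (U z + Cpow (rho z) (S M) * dbar (coefficient M) z)%C.
Proof.
intros Dz Hz; assert (E := sigma_eq z Hz).
induction M as [|M IH].
- change (partial_sum formal_term 1) with (fun w => (0 + formal_term 0 w)%C).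
  rewrite dbar_plus;
    try (apply (smooth_differentiable_at D); auto using smooth_const, smooth_formal_term).
  rewrite dbar_const dbar_formal_term //.
  change (coefficient 0 z) with (sigma z * U z)%C.
  replace (RtoC (INR 1) * Cpow (rho z) 0 * dbar rho z * (sigma z * U z))%C
    with ((dbar rho z * sigma z) * U z)%C by (simpl; ring).
  rewrite E; ring.
- change (partial_sum formal_term (S (S M))) with
    (fun w => (partial_sum formal_term (S M) w + formal_term (S M) w)%C).
  rewrite dbar_plus;
    try (apply (smooth_differentiable_at D); auto using smooth_partial_sum, smooth_formal_term).
  rewrite IH dbar_formal_term //.
  change (coefficient (S M) z) with (- / (INR M + 2) * (sigma z * dbar (coefficient M) z))%C.
  replace (RtoC (INR (S (S M))) * Cpow (rho z) (S M) * dbar rho z *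
     (- / (INR M + 2) * (sigma z * dbar (coefficient M) z)))%C
    with (- (RtoC (INR (S (S M))) * / (INR M + 2)) * Cpow (rho z) (S M) *
     ((dbar rho z * sigma z) * dbar (coefficient M) z))%C by ring.
  rewrite E !S_INR.
  replace (RtoC (INR M + 1 + 1) * / (INR M + 2))%C with (RtoC 1); [ring|].
  assert (P := pos_INR M); rewrite -RtoC_plus -RtoC_inv; [|lra].
  rewrite -RtoC_mult; f_equal; field; lra.
Qed.

Lemma jet_weight_rho_pow N n : jet everywhere (weight rho everywhere) N n (fun z => Cpow (rho z) n).
Proof.
induction n as [|n IH]; [apply (jet_weight_constant rho everywhere N 1)|].
apply (jet_weight_mult rho rho_le1 everywhere N 1 n); [|easy].
now apply (jet_weight_rho rho rho_smooth B0).
Qed.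

Lemma jet_formal_term N k : jet D (weight rho D) N (S k) (formal_term k).
Proof.
rewrite -(Nat.add_0_r (S k)); apply (jet_weight_mult rho rho_le1); auto.
- apply (jet_weight_sub rho everywhere); [easy | apply jet_weight_rho_pow].
- apply (jet_weight_bounded_support rho D B0); auto;
    [apply smooth_coefficient | apply coefficient_support].
Qed.

(** The scale of the cutoff is chosen separately for each term, as in the
    lemma of Borel. *)
Lemma scales_exist k : exists eps, 0 < eps <= 1 /\
  jet D (weight_const rho D ((1 / 2) ^ k)) k k (localised rho cutoff (formal_term k) 0 eps).
Proof.
destruct (jet_localised rho rho_le1 rho_smooth B0 rho_support D k k 0 (formal_term k) cutoff)
  as [M [HM H]].
- lia.
- apply smooth1_cutoff.
- apply cutoff_eq0.
- replace (k + 1 + 2 * 0)%nat with (S k) by lia; apply jet_formal_term.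
- assert (P : 0 < (1 / 2) ^ k) by (apply pow_lt; lra).
  assert (P1 : (1 / 2) ^ k <= 1) by (rewrite -{2}(pow1 k); apply pow_incr; lra).
  assert (E : (M + 1) * ((1 / 2) ^ k / (M + 1)) = (1 / 2) ^ k) by (field; lra).
  assert (Q : 0 < (1 / 2) ^ k / (M + 1)) by (apply Rdiv_lt_0_compat; lra).
  revert E Q; generalize ((1 / 2) ^ k / (M + 1)); intros e E Q.
  assert (R := Rmult_le_pos M e HM (Rlt_le _ _ Q)).
  assert (e1 : e <= 1) by lra.
  exists e; split; [now split|].
  specialize (H e (conj Q e1)); revert H; apply jet_impl; [easy|].
  intros n f; apply weight_const_lower; auto; lra.
Qed.

Definition scale (k : nat) : R :=
  proj1_sig (constructive_indefinite_description _ (scales_exist k)).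

Lemma scale_spec k : 0 < scale k <= 1 /\
  jet D (weight_const rho D ((1 / 2) ^ k)) k k (localised rho cutoff (formal_term k) 0 (scale k)).
Proof. unfold scale; now destruct constructive_indefinite_description. Qed.

Definition borel_term (k : nat) : C -> C := localised rho cutoff (formal_term k) 0 (scale k).

Definition solution : C -> C := sum_series borel_term.

Definition tail (K : nat) : C -> C := sum_series (fun k => borel_term (K + k)).

Lemma smooth_borel_term k : smooth_to_closure D (borel_term k).
Proof.
apply smooth_scal, smooth_mult; [apply smooth_formal_term|].
apply (smooth_sub everywhere); [easy|]; apply smooth_localising; [easy | apply smooth1_cutoff].
Qed.

Lemma borel_term_bound k z : D z -> Cmod (borel_term k z) <= 1 * (1 / 2) ^ k.
Proof.
intros Dz; apply (weight_const_geometric rho rho_le1 D 1 k borel_term); [lra | | easy].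
rewrite Rmult_1_l; exact (jet_head _ _ _ _ _ (proj2 (scale_spec k))).
Qed.

Lemma solution_split K z : D z ->
  solution z = (partial_sum borel_term K z + tail K z)%C.
Proof.
intros Dz; apply (sum_series_split borel_term z 1 K); intros k; now apply borel_term_bound.
Qed.

Lemma jet_tail K : jet D (weight rho D) K K (tail K).
Proof.
assert (P : forall k, 0 < (1 / 2) ^ k) by (intros; apply pow_lt; lra).
apply (jet_sum_series rho rho_le1 D D_open K K ((1 / 2) ^ K)); [now apply Rlt_le|].
intros k; rewrite -pow_add.
apply (jet_lower D (weight_const rho D ((1 / 2) ^ (K + k))) (K + k)) with (n := (K + k)%nat);
  [| lia | lia | apply scale_spec].
intros n n' f Hn; apply weight_const_lower; auto; split; [now apply Rlt_le | lra].
Qed.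

(** For derivatives up to order [N] the terms of index at least [N] form a
    uniformly convergent series; there are finitely many others. *)
Lemma smooth_solution : smooth_to_closure D solution.
Proof.
intros N.
apply (jet_eq D _ N D_open) with (f := fun z => (partial_sum borel_term N z + tail N z)%C).
- intros _ f g; apply cauchy_eq.
- intros z Dz; symmetry; exact (solution_split N z Dz).
- apply (jet_plus D (fun _ => cauchy_at_closure D) (fun _ => cauchy_at_closure D)).
  + intros _ f g; apply cauchy_plus.
  + apply smooth_partial_sum, smooth_borel_term.
  + now apply (jet_weight_cauchy rho) with (n := N), jet_tail.
Qed.

Lemma borel_term_zero k z : rho z = 0 -> borel_term k z = 0.
Proof.
intros H; unfold borel_term, localised, formal_term; rewrite H; simpl; ring.
Qed.

Lemma solution_zero z : rho z = 0 -> solution z = 0.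
Proof.
intros H; apply Cmod_eq_0, Rle_antisym; [|apply Cmod_ge_0].
rewrite -(Rmult_0_r 4); apply sum_series_bound; intros k.
rewrite borel_term_zero // Cmod_0; lra.
Qed.

Lemma solution_weight : weight rho D 1 solution.
Proof.
apply (weight_eq rho D 1) with (f := fun z => (partial_sum borel_term 1 z + tail 1 z)%C).
{ intros z Dz; symmetry; exact (solution_split 1 z Dz). }
apply (weight_plus rho); [|exact (jet_head _ _ _ _ _ (jet_tail 1))].
apply (weight_plus rho D 1 (fun _ => RtoC 0)).
{ exists 0; split; [lra|]; split; [apply cauchy_const|]; intros; rewrite Cmod_0; lra. }
apply (weight_mult rho D 0 1); [exact (jet_head _ _ _ _ _ (jet_weight_constant rho D O _))|].
apply (weight_mult rho D 1 0); [exact (jet_head _ _ _ _ _ (jet_formal_term O 0))|].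
exists 1; split; [lra|]; split.
- apply (cauchy_sub everywhere); [easy|].
  exact (jet_head _ _ _ _ _ (smooth_localising rho rho_smooth cutoff (scale 0) smooth1_cutoff O)).
- intros z _; unfold real_comp; rewrite Cmod_R Rabs_pos_eq; [|apply cutoff_ge0].
  rewrite Rmult_1_r; apply cutoff_le1.
Qed.

Lemma borel_term_near k z : Cmod (rho z) ^ 2 <= scale k ^ 2 / 2 ->
  borel_term k z = formal_term k z.
Proof.
intros H; destruct (scale_spec k) as [P _].
unfold borel_term, localised, real_comp; rewrite square_Cmod; simpl Re.
rewrite cutoff_eq1; [simpl; ring|].
assert (Q : 0 < scale k ^ 2) by (apply pow_lt; lra).
apply Rmult_le_reg_l with (1 := Q); rewrite -Rmult_assoc Rinv_r; lra.
Qed.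

Lemma common_scale K : exists eta, 0 < eta /\ forall k, (k < K)%nat -> eta <= scale k ^ 2 / 2.
Proof.
induction K as [|K [eta [H0 H]]]; [exists 1; split; [lra | lia]|].
assert (P : 0 < scale K ^ 2 / 2).
{ apply Rdiv_lt_0_compat; [apply pow_lt, (proj1 (scale_spec K)) | lra]. }
exists (Rmin eta (scale K ^ 2 / 2)); split; [now apply Rmin_glb_lt|].
intros k Hk; destruct (Nat.eq_dec k K) as [->|Ne]; [apply Rmin_r|].
apply Rle_trans with (1 := Rmin_l _ _), H; lia.
Qed.

Lemma partial_sum_eq T T' K z : (forall k, (k < K)%nat -> T k z = T' k z) ->
  partial_sum T K z = partial_sum T' K z.
Proof.
intros H; induction K as [|K IH]; [easy|]; simpl; rewrite IH ?H //; auto with arith.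
Qed.

Lemma jet_weight_dbar D' N n f : open_plane D' ->
  jet D' (weight rho D') (S N) (S n) f -> jet D' (weight rho D') N n (dbar f).
Proof.
intros HD' H.
assert (P : forall a, jet D' (weight rho D') N n (partial a f)).
{ intros a; apply (jet_partial D' (weight rho D') N (S n)); auto; intros k u v; apply weight_eq. }
assert (K : forall (c : C) g, jet D' (weight rho D') N n g -> jet D' (weight rho D') N n (fun z => c * g z)%C).
{ intros c g G; apply (jet_weight_mult rho rho_le1 D' N 0 n); [|easy].
  apply jet_weight_constant. }
apply K, jet_weight_plus; [|apply K]; apply P.
Qed.

(** Where [dbar rho] is inverted by [sigma] and, if [eta] is small, finitely
    many given terms are not affected by their cutoffs. *)
Definition near_curve (eta : R) (z : C) : Prop :=
  D z /\ m ^ 2 / 2 < Cmod (dbar rho z) ^ 2 /\ Cmod (rho z) ^ 2 < eta.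

Lemma near_curve_open eta : open_plane (near_curve eta).
Proof.
assert (S := smooth_dbar_rho).
assert (S1 := smooth_mult _ _ _ S (smooth_conj _ _ S)).
assert (S2 := smooth_scal _ (-1) _ (smooth_square rho rho_smooth)).
intros z [Dz [Z1 Z2]].
destruct (D_open z Dz) as [d1 [P1 H1]].
destruct (open_plane_Re_gt _ (m ^ 2 / 2) (jet_head _ _ _ _ _ (S1 O)) z) as [d2 [P2 H2]].
{ now rewrite -Cmod2_conj. }
destruct (open_plane_Re_gt _ (- eta) (jet_head _ _ _ _ _ (S2 O)) z) as [d3 [P3 H3]].
{ rewrite square_Cmod -RtoC_mult; simpl Re; lra. }
exists (Rmin d1 (Rmin d2 d3)); split; [repeat apply Rmin_glb_lt; easy|].
assert (L1 := Rmin_l d1 (Rmin d2 d3)); assert (L := Rmin_r d1 (Rmin d2 d3)).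
assert (L2 := Rle_trans _ _ _ L (Rmin_l d2 d3)); assert (L3 := Rle_trans _ _ _ L (Rmin_r d2 d3)).
intros w Hw; split; [|split].
- apply H1, (near_le _ _ _ _ L1 Hw).
- assert (X := H2 w (near_le _ _ _ _ L2 Hw)); now rewrite -Cmod2_conj in X.
- assert (X := H3 w (near_le _ _ _ _ L3 Hw)); rewrite square_Cmod -RtoC_mult in X.
  simpl Re in X; lra.
Qed.

(** Near the curve the solution is a partial sum of the formal solution plus a
    tail that vanishes to high order, and [dbar] of the partial sum is [U] up
    to a function that also vanishes to high order. *)
Lemma residual_jet N : exists eta, 0 < eta /\
  jet (near_curve eta) (weight rho (near_curve eta)) N N
    (fun z => dbar solution z - U z)%C.
Proof.
destruct (common_scale (S (S N))) as [eta [H0 H]]; exists eta; split; [easy|].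
set (D' := near_curve eta).
assert (HD' : open_plane D') by apply near_curve_open.
assert (D'D : forall z, D' z -> D z) by now intros z [].
apply (jet_eq D' _ N HD') with
  (f := fun z => (Cpow (rho z) (S (S N)) * dbar (coefficient (S N)) z + dbar (tail (S (S N))) z)%C).
{ intros n f g; apply weight_eq. }
{ intros z Hz; destruct (HD' z Hz) as [d [Hd HB]].
  rewrite (dbar_eq_near solution
     (fun w => partial_sum formal_term (S (S N)) w + tail (S (S N)) w)%C z d Hd).
  - rewrite dbar_plus.
    + rewrite dbar_formal_sum; [ring | now apply D'D | apply Rlt_le, Hz].
    + intros a; apply (smooth_differentiable D); [apply smooth_partial_sum, smooth_formal_term | now apply D'D].
    + intros a; apply (jet_is_partial D (weight rho D) (S N) (S (S N))); [apply jet_tail | now apply D'D].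
  - intros w Hw; rewrite (solution_split (S (S N))); [|apply D'D, HB, Hw].
    f_equal; apply partial_sum_eq; intros k Hk; apply borel_term_near.
    destruct (HB w Hw) as [_ [_ L]]; generalize (H k Hk); lra. }
apply (jet_weight_plus rho).
- apply (jet_weight_lower rho rho_le1 D' N (S (S N) + 0)); [lia | lia|].
  apply (jet_weight_mult rho rho_le1).
  + apply (jet_weight_sub rho everywhere); [easy | apply jet_weight_rho_pow].
  + apply (jet_weight_sub rho D); [easy|].
    apply (jet_weight_bounded_support rho D B0); auto.
    * apply smooth_dbar, smooth_coefficient; easy.
    * intros z Hz; unfold dbar.
      rewrite !(vanishes_off_box_partial B0 _ _ (coefficient_support (S N)) z Hz); ring.
- apply jet_weight_dbar; [easy|].
  apply (jet_weight_sub rho D); [easy|].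
  apply (jet_weight_lower rho rho_le1 D (S (S N)) (S (S N))); [lia | lia | apply jet_tail].
Qed.

Lemma formal_solution_realised : exists phi,
  smooth_to_closure D phi /\ weight rho D 1 phi /\ (forall z, rho z = 0 -> phi z = 0) /\
  forall N, exists eta, 0 < eta /\
    jet (near_curve eta) (weight rho (near_curve eta)) N N (fun z => dbar phi z - U z)%C.
Proof.
exists solution; split; [apply smooth_solution|]; split; [apply solution_weight|].
split; [apply solution_zero | apply residual_jet].
Qed.

End Solution.

(** * Solution along the curve *)

(** Both parts of the theorem in one: [D] is the domain or the plane, and
    vanishing along the curve is expressed by domination by [rho]. *)
Lemma dbar_solvable gamma D U : smooth_jordan_param gamma -> open_plane D ->
  smooth_to_closure D U ->
  exists rho phi c, cauchy_at_closure everywhere rho /\ (forall t, rho (gamma t) = 0) /\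
    smooth_to_closure D phi /\ (forall z, rho z = 0 -> phi z = 0) /\
    (forall z, D z -> Cmod (phi z) <= c * Cmod (rho z)) /\
    forall w t, exists d c', 0 < d /\ forall z, D z -> near (gamma t) d z ->
      Cmod (partials w (fun z => dbar phi z - U z)%C z) <= c' * Cmod (rho z).
Proof.
intros Hg HD HU.
destruct (defining_function gamma Hg) as [rho [m [B [S [Hm [V [L1 [Z G]]]]]]]].
destruct (formal_solution_realised rho L1 S B V m Hm D U HD HU) as [phi [Sp [[c [_ [_ Hc]]] [Zp HF]]]].
exists rho, phi, c; split; [exact (jet_head _ _ _ _ _ (S O))|].
do 3 (split; [easy|]); split.
{ intros z Dz; rewrite -(pow_1 (Cmod (rho z))); now apply Hc. }
intros w t; destruct (HF (length w + 1)%nat) as [eta [He J]].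
assert (HD' := near_curve_open rho S m D HD eta).
apply jet_partials, jet_head in J; [|easy | intros n f g; apply weight_eq].
replace (length w + 1 - length w)%nat with 1%nat in J by lia.
destruct J as [c' [_ [_ Hc']]].
destruct (near_curve_open rho S m everywhere open_plane_everywhere eta (gamma t)) as [d [Hd HB]].
{ destruct (G t) as [l [El Hl]]; split; [easy|]; rewrite El Z Cmod_0 Cmod_R pow2_abs; split; [|lra].
  assert (P := pow_lt m 2 Hm); assert (m ^ 2 <= l ^ 2) by (apply pow_incr; lra); lra. }
exists d, c'; split; [easy|]; intros z Dz Nz; destruct (HB z Nz) as [_ Hz].
rewrite -(pow_1 (Cmod (rho z))); apply Hc'; now split.
Qed.

(** * The function spaces of the problem *)

Lemma cauchy_limit D f p : cauchy_at_closure D f -> closure D p ->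
  exists l, forall eps, 0 < eps -> exists d, 0 < d /\
    forall z, D z -> near p d z -> Cmod (f z - l) < eps.
Proof.
intros F Hp.
assert (PF : ProperFilter (within D (locally p))).
{ split; [|apply within_filter, locally_filter].
  intros P HP; destruct (Hp _ HP) as [w [H1 H2]]; exists w; auto. }
assert (L : forall pr : C -> R, (forall z, Rabs (pr z) <= Cmod z) ->
   (forall z w, pr (z - w)%C = pr z - pr w) ->
   exists l, forall eps, 0 < eps -> exists d, 0 < d /\
     forall z, D z -> near p d z -> Rabs (pr (f z) - l) < eps).
{ intros pr Hpr Hlin.
  destruct (proj1 (filterlim_locally_cauchy (F := within D (locally p)) (fun z => pr (f z)))) as [l Hl].
  - intros eps; destruct (F p eps (cond_pos eps)) as [d [Hd HB]].
    exists (fun z => D z /\ near p d z); split.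
    + apply locally_near; exists d; split; auto.
    + intros u v [Du Nu] [Dv Nv]; apply: Rle_lt_trans (HB v u Dv Du Nv Nu).
      rewrite /minus /= -[_ (pr (f v)) _]/(pr (f v) - pr (f u)) -Hlin; apply Hpr.
  - exists l; intros eps He.
    assert (X := proj1 (filterlim_locally _ _) Hl (mkposreal eps He)).
    apply locally_near in X; destruct X as [d [Hd HB]]; exists d; split; [easy|].
    intros z Dz Nz; exact (HB z Nz Dz). }
destruct (L Re Rabs_Re_le ltac:(easy)) as [a Ha].
destruct (L Im Rabs_Im_le ltac:(easy)) as [b Hb].
exists (a, b); intros eps He.
destruct (Ha (eps / 2) ltac:(lra)) as [d1 [P1 H1]].
destruct (Hb (eps / 2) ltac:(lra)) as [d2 [P2 H2]].
exists (Rmin d1 d2); split; [now apply Rmin_glb_lt|]; intros z Dz Nz.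
apply Rle_lt_trans with (1 := Cmod_le_sum _).
assert (A := H1 z Dz (near_le _ _ _ _ (Rmin_l _ _) Nz)).
assert (A' := H2 z Dz (near_le _ _ _ _ (Rmin_r _ _) Nz)).
simpl; unfold Rminus in A, A'; unfold Re, Im in A, A'; lra.
Qed.

Lemma ball_Cmod (z w : C) (eps : posreal) : Cmod (w - z) < eps -> ball z eps w.
Proof.
intros H; split.
- apply: Rle_lt_trans (Rabs_Re_le (w - z)) H.
- apply: Rle_lt_trans (Rabs_Im_le (w - z)) H.
Qed.

Lemma Cmod_ball (z w : C) (eps : posreal) : ball z eps w -> Cmod (w - z) < eps + eps.
Proof.
intros [A B]; apply Rle_lt_trans with (1 := Cmod_le_sum _).
apply Rplus_lt_compat; [exact A | exact B].
Qed.

Lemma continuous_on_near (A : C -> Prop) (f : C -> C) :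
  (forall p, A p -> forall eps, 0 < eps -> exists d, 0 < d /\
    forall z, A z -> near p d z -> Cmod (f z - f p) < eps) ->
  continuous_on A f.
Proof.
intros H p Ap; apply filterlim_locally; intros eps.
destruct (H p Ap eps (cond_pos eps)) as [d [Hd HB]].
apply locally_near; exists d; split; [easy|]; intros z Nz Az; now apply ball_Cmod, HB.
Qed.

Lemma near_of_continuous_on (A : C -> Prop) (f : C -> C) p eps : continuous_on A f -> A p -> 0 < eps ->
  exists d, 0 < d /\ forall z, A z -> near p d z -> Cmod (f z - f p) < eps.
Proof.
intros H Ap He.
assert (X := proj1 (filterlim_locally _ _) (H p Ap) (mkposreal (eps / 2) ltac:(lra))).
apply locally_near in X; destruct X as [d [Hd HB]]; exists d; split; [easy|].
intros z Az Nz; assert (Y := Cmod_ball _ _ _ (HB z Nz Az)); simpl in Y; lra.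
Qed.

Lemma closure_incl (D : C -> Prop) z : D z -> closure D z.
Proof. intros Dz N HN; exists z; split; [now apply locally_singleton | easy]. Qed.

Lemma not_closure_near D p : ~ closure D p -> exists d, 0 < d /\ forall z, near p d z -> ~ D z.
Proof.
intros H; apply NNPP; intros K; apply H; intros N HN.
apply locally_near in HN; destruct HN as [d [Hd HB]].
apply NNPP; intros L; apply K; exists d; split; [easy|].
intros z Nz Dz; apply L; exists z; auto.
Qed.

Lemma closure_near D p d : closure D p -> 0 < d -> exists z, D z /\ near p d z.
Proof.
intros H Hd; destruct (H (near p d)) as [z [A B]]; [apply locally_near; exists d; auto | now exists z].
Qed.

Lemma cauchy_of_extension D f h : continuous_extension D f h -> cauchy_at_closure D f.
Proof.
intros [H E]; apply (cauchy_eq D h); [easy|].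
apply (cauchy_of_limits D h h); intros p eps He.
destruct (classic (closure D p)) as [Hp|Hp].
- destruct (near_of_continuous_on _ h p eps H Hp He) as [d [Hd HB]].
  exists d; split; [easy|]; intros z Dz Nz; apply HB; [now apply closure_incl | easy].
- destruct (not_closure_near D p Hp) as [d [Hd HB]].
  exists d; split; [easy|]; intros z Dz Nz; now case: (HB z Nz).
Qed.

(** The extension is chosen pointwise as a limit. *)
Lemma extension_of_cauchy D f : cauchy_at_closure D f -> exists h, continuous_extension D f h.
Proof.
intros F.
assert (L : forall p, exists l, closure D p -> forall eps, 0 < eps -> exists d, 0 < d /\
    forall z, D z -> near p d z -> Cmod (f z - l) < eps).
{ intros p; destruct (classic (closure D p)) as [Hp|Hp].
  - destruct (cauchy_limit D f p F Hp) as [l Hl]; now exists l.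
  - now exists 0. }
pose (h p := proj1_sig (constructive_indefinite_description _ (L p))).
assert (Hh : forall p, closure D p -> forall eps, 0 < eps -> exists d, 0 < d /\
    forall z, D z -> near p d z -> Cmod (f z - h p) < eps).
{ intros p; unfold h; now destruct constructive_indefinite_description. }
exists h; split.
- apply continuous_on_near; intros p Hp eps He.
  destruct (Hh p Hp (eps / 2) ltac:(lra)) as [d [Hd HB]].
  exists (d / 2); split; [lra|]; intros q Hq Nq.
  destruct (Hh q Hq (eps / 2) ltac:(lra)) as [e [He' HE]].
  destruct (closure_near D q (Rmin e (d / 2)) Hq) as [z [Dz Nz]]; [apply Rmin_glb_lt; lra|].
  assert (N1 := near_le _ _ _ _ (Rmin_l _ _) Nz); assert (N2 := near_le _ _ _ _ (Rmin_r _ _) Nz).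
  assert (Np : near p d z).
  { destruct N2 as [A A'], Nq as [B B']; split; apply Rabs_lt_between;
    apply Rabs_lt_between in A, A', B, B'; lra. }
  replace (h q - h p)%C with ((f z - h p) + - (f z - h q))%C by ring.
  apply Rle_lt_trans with (1 := Cmod_triangle _ _); rewrite Cmod_opp.
  generalize (HE z Dz N1) (HB z Dz Np); lra.
- intros z Dz; assert (K := Hh z (closure_incl D z Dz)).
  assert (E : Cmod (f z - h z) = 0).
  { apply cond_eq; intros eps He; destruct (K eps He) as [d [Hd HB]].
    rewrite Rminus_0_r Rabs_pos_eq; [|apply Cmod_ge_0].
    apply HB; [easy | now apply near_center]. }
  apply Cmod_eq_0 in E; symmetry; replace (f z) with ((f z - h z) + h z)%C by ring.
  rewrite E; ring.
Qed.

Lemma is_partial_of_ex a f z : ex_partial a f z -> is_partial a f z (partial a f z).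
Proof. intros [A B]; split; now apply Derive_correct. Qed.

Lemma smooth_to_closure_of_partials D f :
  (forall w z, D z -> forall a, ex_partial a (partials w f) z) ->
  (forall w, cauchy_at_closure D (partials w f)) -> smooth_to_closure D f.
Proof.
intros P F.
assert (J : forall N w, jet D (fun _ => cauchy_at_closure D) N 0 (partials w f)).
{ induction N as [|N IH]; intros w; split; auto.
  intros a; exists (partial a (partials w f)); split; [|exact (IH (a :: w))].
  intros z Dz; apply is_partial_of_ex; auto. }
intros N; exact (J N nil).
Qed.

Lemma smooth_partials D f w : open_plane D -> smooth_to_closure D f ->
  smooth_to_closure D (partials w f).
Proof. intros HD F; induction w as [|a w IH]; [easy | now apply smooth_partial]. Qed.

Lemma cauchy_near D f z eps : cauchy_at_closure D f -> open_plane D -> D z -> 0 < eps ->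
  exists d, 0 < d /\ forall w, near z d w -> D w /\ Cmod (f w - f z) < eps.
Proof.
intros F HD Dz He; destruct (F z eps He) as [d [Hd HB]]; destruct (HD z Dz) as [e [H0 HE]].
exists (Rmin d e); split; [now apply Rmin_glb_lt|]; intros w Nw.
assert (Dw := HE w (near_le _ _ _ _ (Rmin_r _ _) Nw)); split; [easy|].
apply HB; auto; [apply (near_le _ _ _ _ (Rmin_l _ _) Nw) | now apply near_center].
Qed.

Lemma smooth_on_of_smooth_to_closure D f : open_plane D -> smooth_to_closure D f -> smooth_on D f.
Proof.
intros HD F w z Dz; assert (S := smooth_partials D f w HD F); split.
- apply filterlim_locally; intros eps.
  destruct (cauchy_near D _ z eps (jet_head _ _ _ _ _ (S O)) HD Dz (cond_pos eps)) as [d [Hd HB]].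
  apply locally_near; exists d; split; [easy|]; intros v Nv; now apply ball_Cmod, HB.
- intros a; apply (is_partial_ex a _ z (partial a (partials w f) z)).
  now apply (smooth_differentiable D).
Qed.

Lemma smooth_to_closure_of_smooth f : smooth f -> smooth_to_closure everywhere f.
Proof.
intros S; apply smooth_to_closure_of_partials; [intros w z _; now apply S|].
intros w; apply (cauchy_of_limits _ _ (partials w f)); intros p eps He.
assert (X := proj1 (filterlim_locally _ _) (proj1 (S w p I)) (mkposreal (eps / 2) ltac:(lra))).
apply locally_near in X; destruct X as [d [Hd HB]]; exists d; split; [easy|].
intros z _ Nz; assert (Y := Cmod_ball _ _ _ (HB z Nz)); simpl in Y; lra.
Qed.

Lemma smooth_to_closure_of_smooth_closure D f : smooth_closure D f -> smooth_to_closure D f.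
Proof.
intros [S [_ E]]; apply smooth_to_closure_of_partials; [intros w z Dz; now apply S|].
intros w; destruct (E w) as [h Hh]; exact (cauchy_of_extension D _ h Hh).
Qed.

Lemma closure_cases D z : closure D z -> D z \/ boundary D z.
Proof.
intros H; destruct (classic (D z)) as [Dz|Dz]; [now left | right].
split; [easy | now apply closure_incl].
Qed.

Lemma boundary_not_in D z : open_plane D -> boundary D z -> ~ D z.
Proof.
intros HD [_ H] Dz; destruct (HD z Dz) as [d [Hd HB]].
destruct (closure_near _ z d H Hd) as [w [A B]]; apply A, HB, B.
Qed.

(** For the solution itself, and for the derivatives of the residual extended
    by zero: both are dominated by [rho], hence tend to [0] at the boundary. *)
Lemma continuous_on_closure_of_domination D (rho g h : C -> C) : open_plane D ->
  cauchy_at_closure everywhere rho -> cauchy_at_closure D g ->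
  (forall p, boundary D p -> rho p = 0 /\ exists d c, 0 < d /\
     forall z, D z -> near p d z -> Cmod (g z) <= c * Cmod (rho z)) ->
  (forall z, D z -> h z = g z) -> (forall z, boundary D z -> h z = 0) ->
  continuous_on (closure D) h.
Proof.
intros HD R G H E Z; apply continuous_on_near; intros p Hp eps He.
destruct (closure_cases D p Hp) as [Dp|Bp].
- destruct (cauchy_near D g p eps G HD Dp He) as [d [Hd HB]].
  exists d; split; [easy|]; intros z _ Nz; destruct (HB z Nz) as [Dz Hz].
  now rewrite (E z Dz) (E p Dp).
- destruct (H p Bp) as [R0 [d [c [Hd HB]]]].
  assert (Pc : 0 < Rabs c + 1) by (generalize (Rabs_pos c); lra).
  destruct (R p (eps / (Rabs c + 1))) as [e [H0 HE]]; [now apply Rdiv_lt_0_compat|].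
  exists (Rmin d e); split; [now apply Rmin_glb_lt|]; intros z Hz Nz.
  rewrite (Z p Bp); replace (h z - 0)%C with (h z) by ring.
  destruct (closure_cases D z Hz) as [Dz|Bz]; [|now rewrite (Z z Bz) Cmod_0].
  rewrite (E z Dz); apply Rle_lt_trans with (1 := HB z Dz (near_le _ _ _ _ (Rmin_l _ _) Nz)).
  assert (X := HE z p I I (near_le _ _ _ _ (Rmin_r _ _) Nz) (near_center _ _ H0)).
  rewrite R0 in X; replace (rho z - 0)%C with (rho z) in X by ring.
  apply Rle_lt_trans with ((Rabs c + 1) * Cmod (rho z)).
  + apply Rmult_le_compat_r; [apply Cmod_ge_0 | generalize (Rle_abs c); lra].
  + apply Rlt_le_trans with ((Rabs c + 1) * (eps / (Rabs c + 1))).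
    * now apply Rmult_lt_compat_l.
    * right; field; lra.
Qed.

Theorem theorem1p3 (Omega : C -> Prop) (hOmega : smooth_jordan_domain Omega) :
  (forall U : C -> C, smooth_closure Omega U ->
     exists phi : C -> C,
       smooth_closure Omega phi /\
       vanishes_on (boundary Omega) phi /\
       agree_infinite_order_closure Omega (dbar phi) U) /\
  (forall V : C -> C, smooth V ->
     exists Phi : C -> C,
       smooth Phi /\
       vanishes_on (boundary Omega) Phi /\
       agree_infinite_order (boundary Omega) (dbar Phi) V).
Proof.
destruct hOmega as [[HO _] [_ [_ [gamma [Hg HK]]]]].
assert (HD := open_plane_open Omega HO); split.
- intros U HU; apply smooth_to_closure_of_smooth_closure in HU.
  destruct (dbar_solvable gamma Omega U Hg HD HU) as [rho [phi [c [Hr [Z [S [V [Hc HF]]]]]]]].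
  assert (ZK : forall z, boundary Omega z -> rho z = 0).
  { intros z Bz; apply HK in Bz; destruct Bz as [t <-]; apply Z. }
  assert (VK : vanishes_on (boundary Omega) phi) by (intros z Bz; now apply V, ZK).
  exists phi; split; [split; [|split] | split; [easy|]].
  + now apply smooth_on_of_smooth_to_closure.
  + apply (continuous_on_closure_of_domination Omega rho phi); auto.
    * exact (jet_head _ _ _ _ _ (S O)).
    * intros p Bp; split; [auto|]; exists 1, c; split; [lra | auto].
  + intros w; apply extension_of_cauchy.
    exact (jet_head _ _ _ _ _ (smooth_partials Omega phi w HD S O)).
  + intros w; pose (g := partials w (fun z => (dbar phi z - U z)%C)).
    exists (fun z => match excluded_middle_informative (Omega z) with left _ => g z | right _ => 0 end).
    assert (B0 : forall z, boundary Omega z ->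
      match excluded_middle_informative (Omega z) with left _ => g z | right _ => 0 end = 0).
    { intros z Bz; destruct excluded_middle_informative as [Dz|]; [|easy].
      now case: (boundary_not_in Omega z HD Bz). }
    assert (D0 : forall z, Omega z ->
      match excluded_middle_informative (Omega z) with left _ => g z | right _ => 0 end = g z).
    { intros z Dz; now destruct excluded_middle_informative. }
    split; [split|]; auto.
    apply (continuous_on_closure_of_domination Omega rho g); auto.
    * assert (SG : smooth_to_closure Omega (fun z => dbar phi z - U z)%C).
      { apply (smooth_ext Omega (fun z => dbar phi z + -1 * U z)%C); [intros; ring|].
        apply smooth_plus; [now apply smooth_dbar | now apply smooth_scal]. }
      exact (jet_head _ _ _ _ _ (smooth_partials Omega _ w HD SG O)).
    * intros p Bp; split; [auto|]; apply HK in Bp; destruct Bp as [t <-].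
      destruct (HF w t) as [d [c' [Hd HB]]]; now exists d, c'.
- intros V HV; apply smooth_to_closure_of_smooth in HV.
  destruct (dbar_solvable gamma everywhere V Hg open_plane_everywhere HV)
    as [rho [phi [c [_ [Z [S [V0 [_ HF]]]]]]]].
  exists phi; split; [|split].
  + now apply smooth_on_of_smooth_to_closure; [apply open_plane_everywhere|].
  + intros z Bz; apply HK in Bz; destruct Bz as [t <-]; apply V0, Z.
  + intros w z Bz; apply HK in Bz; destruct Bz as [t <-].
    destruct (HF w t) as [d [c' [Hd HB]]].
    apply Cmod_eq_0, Rle_antisym; [|apply Cmod_ge_0].
    apply Rle_trans with (1 := HB (gamma t) I (near_center _ _ Hd)); rewrite Z Cmod_0; lra.
Qed.
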